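(* Let $\mathbb{F}$ be a quadratically closed field of characteristic not equal to $2$ or $3$, and let $A$ be a $3$-generated algebra of Jordan type $\frac{1}{2}$ over $\mathbb{F}$ whose Frobenius form has trivial radical, $R(A)=0$. Then $A$ is isomorphic to one of the following algebras: (1) $\mathbb{F}^n$, $n\in\{1,2,3\}$ (direct sum of $n$ copies of $\mathbb{F}$); (2) $JForm_2(\mathbb{F})$; (3) $\mathbb{F}\oplus JForm_2(\mathbb{F})$; (4) $M_2^{+}(\mathbb{F})$; (5) $H(M_3(\mathbb{F}),j)$ with $j(X)=X^T$; (6) $M_3^{+}(\mathbb{F})$.
   Context: All algebras are commutative, not necessarily associative algebras over $\mathbb{F}$. A field is quadratically closed if each of its elements is a square. For $a\in A$ and $\lambda\in\mathbb{F}$ put $A_\lambda(a)=\{u\in A: au=\lambda u\}$. An idempotent $a\in A$ is primitive if $\dim A_1(a)=1$. An axis is a primitive idempotent $x\in A$ such that $A=A_0(x)\oplus A_1(x)\oplus A_{\frac12}(x)$ and the following fusion rules hold: $A_0(x)A_{\frac12}(x)\subseteq A_{\frac12}(x)$, $A_1(x)A_{\frac12}(x)\subseteq A_{\frac12}(x)$, $A_0(x)A_1(x)=0$, $A_0(x)^2\subseteq A_0(x)$, $A_1(x)^2\subseteq A_1(x)$, $A_{\frac12}(x)^2\subseteq A_0(x)\oplus A_1(x)$. The algebra $A$ is of Jordan type $\frac12$ if it is generated as an algebra by a set of axes; it is $3$-generated if it is generated by three axes (not necessarily distinct). Frobenius form: a nonzero symmetric bilinear form on $A$ with $(ab,c)=(ac,b)$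 for all $a,b,c\in A$ and $(a,a)\ne 0$ for each axis $a$. It is known that an algebra of Jordan type $\frac12$ has a unique Frobenius form with $(a,a)=1$ for every axis $a$; $(\cdot,\cdot)$ always denotes this form. The radical is $R(A)=\{x\in A:(x,y)=0\ \text{for all } y\in A\}$, an ideal. $M_n^+(\mathbb{F})$ is the space of $n\times n$ matrices over $\mathbb{F}$ with product $X\circ Y=\frac12(XY+YX)$. $H(M_n(\mathbb{F}),j)=\{X\in M_n^+(\mathbb{F}): j(X)=X\}$ with the product $\circ$; for $j(X)=X^T$ this is the algebra of symmetric matrices. $JForm_n(\mathbb{F})$ is the vector space $\mathbb{F}\oplus V$, where $V$ is an $n$-dimensional vector space over $\mathbb{F}$ with a nondegenerate symmetric bilinear form $\phi$, with product $(a\oplus \mathbf v)\bullet(b\oplus \mathbf w)=(ab+\phi(\mathbf v,\mathbf w))\oplus(a\mathbf w+b\mathbf v)$ (over a quadratically closed field of characteristic not $2$ it does not depend on $\phi$ up to isomorphism). *)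

(* Defs.v *)
From HB Require Import structures.
From mathcomp Require Import all_boot all_algebra.

Set Implicit Arguments.
Unset Strict Implicit.
Unset Printing Implicit Defensive.

Import GRing.Theory.
Local Open Scope ring_scope.

Definition quadratically_closed (F : fieldType) : Prop :=
  forall x : F, exists y : F, y ^+ 2 = x.

(* Commutative algebras that need not be associative or unital, of arbitrary
   dimension. *)
HB.mixin Record Lmodule_isComNAlgebra (F : fieldType) A
    of GRing.Lmodule F A := {
  nmul : A -> A -> A;
  nmulC : commutative nmul;
  nmulPl : forall (c : F) (x y z : A),
    nmul (c *: x + y) z = c *: nmul x z + nmul y z
}.

#[short(type="comNAlgType")]
HB.structure Definition ComNAlgebra (F : fieldType) :=
  { A of Lmodule_isComNAlgebra F A & GRing.Lmodule F A }.

Notation "x ** y" := (nmul x y) (at level 40, left associativity) : ring_scope.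

Definition alg_iso (F : fieldType) (A B : comNAlgType F) : Prop :=
  exists f : {linear A -> B},
    bijective f /\ (forall x y : A, f (x ** y) = f x ** f y).

Definition eigen (F : fieldType) (A : comNAlgType F) (lambda : F) (a : A) :
  A -> Prop := fun u => a ** u = lambda *: u.

Definition dim_one (F : fieldType) (V : lmodType F) (S : V -> Prop) : Prop :=
  exists v : V, [/\ S v, v != 0 & forall u, S u <-> exists c : F, u = c *: v].

Definition sum_sub (F : fieldType) (V : lmodType F) (S T : V -> Prop) :
  V -> Prop := fun z => exists x y : V, [/\ S x, T y & z = x + y].

(* The product of two subspaces is the span of the products, so its inclusion in
   a subspace U amounts to the membership of the products in U. *)
Definition mul_sub (F : fieldType) (A : comNAlgType F) (S T U : A -> Prop) :
  Prop := forall x y : A, S x -> T y -> U (x ** y).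

Definition idempotent_elt (F : fieldType) (A : comNAlgType F) (a : A) : Prop :=
  a ** a = a.

Definition primitive (F : fieldType) (A : comNAlgType F) (a : A) : Prop :=
  dim_one (eigen 1 a).

(* A = A_0(x) + A_1(x) + A_{1/2}(x), as a direct sum. *)
Definition peirce_decomposition (F : fieldType) (A : comNAlgType F) (x : A) :
  Prop :=
  forall u : A, exists! p : A * A * A,
    [/\ eigen 0 x p.1.1, eigen 1 x p.1.2, eigen 2%:R^-1 x p.2
      & u = p.1.1 + p.1.2 + p.2].

Definition fusion_rules (F : fieldType) (A : comNAlgType F) (x : A) : Prop :=
  let A0 := eigen 0 x in
  let A1 := eigen 1 x in
  let Ah := eigen 2%:R^-1 x in
  [/\ mul_sub A0 Ah Ah /\ mul_sub A1 Ah Ah,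
      mul_sub A0 A1 (fun z => z = 0),
      mul_sub A0 A0 A0 /\ mul_sub A1 A1 A1
    & mul_sub Ah Ah (sum_sub A0 A1)].

Definition axis (F : fieldType) (A : comNAlgType F) (x : A) : Prop :=
  [/\ idempotent_elt x, primitive x, peirce_decomposition x & fusion_rules x].

Definition subalgebra (F : fieldType) (A : comNAlgType F) (S : A -> Prop) :
  Prop :=
  [/\ S 0, (forall (c : F) (x y : A), S x -> S y -> S (c *: x + y))
    & mul_sub S S S].

Definition generates (F : fieldType) (A : comNAlgType F) (X : A -> Prop) :
  Prop :=
  forall S : A -> Prop, subalgebra S -> (forall x, X x -> S x) ->
  forall x, S x.

Definition jordan_type_half (F : fieldType) (A : comNAlgType F) : Prop :=
  exists X : A -> Prop, (forall x, X x -> axis x) /\ generates X.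

Definition three_generated (F : fieldType) (A : comNAlgType F) : Prop :=
  exists a b c : A, [/\ axis a, axis b, axis c
    & generates (fun x => [\/ x = a, x = b | x = c])].

Definition frobenius_form (F : fieldType) (A : comNAlgType F)
    (B : {symmetric A}) : Prop :=
  [/\ exists x y : A, B x y != 0,
      forall a b c : A, B (a ** b) c = B (a ** c) b
    & forall a : A, axis a -> B a a != 0].

(* These conditions determine the form uniquely when A is generated by axes. *)
Definition normalized_frobenius_form (F : fieldType) (A : comNAlgType F)
    (B : {symmetric A}) : Prop :=
  frobenius_form B /\ (forall a : A, axis a -> B a a = 1).

Definition in_radical (F : fieldType) (A : comNAlgType F) (B : {symmetric A})
    (x : A) : Prop := forall y : A, B x y = 0.

(* F as an algebra over itself is F^o. *)

Section Regular.
Variable F : fieldType.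

Fact regular_nmulPl (c : F) (x y z : F^o) :
  (c *: x + y) * z = c *: (x * z) + y * z.
Proof. by rewrite mulrDl scalerAl. Qed.

HB.instance Definition _ :=
  Lmodule_isComNAlgebra.Build F F^o (@mulrC F) regular_nmulPl.

End Regular.

Section DirectSum.
Variables (F : fieldType) (A B : comNAlgType F).

Definition pair_nmul (x y : A * B) : A * B := (x.1 ** y.1, x.2 ** y.2).

Fact pair_nmulC : commutative pair_nmul.
Proof. by move=> x y; rewrite /pair_nmul nmulC [x.2 ** _]nmulC. Qed.

Fact pair_nmulPl (c : F) (x y z : A * B) :
  pair_nmul (c *: x + y) z = c *: pair_nmul x z + pair_nmul y z.
Proof. by rewrite /pair_nmul !nmulPl. Qed.

HB.instance Definition _ :=
  Lmodule_isComNAlgebra.Build F (A * B)%type pair_nmulC pair_nmulPl.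

End DirectSum.

Section DirectPower.
Variables (F : fieldType) (I : finType) (A : comNAlgType F).

Definition ffun_nmul (f g : {ffun I -> A}) : {ffun I -> A} :=
  [ffun i => f i ** g i].

Fact ffun_nmulC : commutative ffun_nmul.
Proof. by move=> f g; apply/ffunP=> i; rewrite !ffunE nmulC. Qed.

Fact ffun_nmulPl (c : F) (f g h : {ffun I -> A}) :
  ffun_nmul (c *: f + g) h = c *: ffun_nmul f h + ffun_nmul g h.
Proof. by apply/ffunP=> i; rewrite !ffunE nmulPl. Qed.

HB.instance Definition _ :=
  Lmodule_isComNAlgebra.Build F {ffun I -> A} ffun_nmulC ffun_nmulPl.

End DirectPower.

Notation power_alg F n := {ffun 'I_n -> F^o}.

Definition jform (F : fieldType) (V : vectType F) (phi : {symmetric V}) : Type :=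
  (F^o * V)%type.

Section JForm.
Variables (F : fieldType) (V : vectType F) (phi : {symmetric V}).

HB.instance Definition _ := GRing.Lmodule.copy (jform phi) (F^o * V)%type.

Definition jform_nmul (x y : jform phi) : jform phi :=
  (x.1 * y.1 + phi x.2 y.2, x.1 *: y.2 + y.1 *: x.2).

Fact jform_nmulC : commutative jform_nmul.
Proof.
move=> x y; rewrite /jform_nmul mulrC [_ *: x.2 + _]addrC.
by rewrite hermitian_subproof expr0 mul1r.
Qed.

Fact jform_nmulPl (c : F) (x y z : jform phi) :
  jform_nmul (c *: x + y) z = c *: jform_nmul x z + jform_nmul y z.
Proof.
rewrite /jform_nmul; congr pair => /=.
  rewrite linearPl mulrDl scalerDr addrACA; congr (_ + _ + _).
  by rewrite /GRing.scale/= mulrA.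
by rewrite scalerDl !scalerDr !scalerA addrACA [z.1 * c]mulrC.
Qed.

HB.instance Definition _ :=
  Lmodule_isComNAlgebra.Build F (jform phi) jform_nmulC jform_nmulPl.

End JForm.

(* A choice of V and phi in the definition of JForm_n(F).  Over a quadratically
   closed field of characteristic not 2, all choices for a given n yield
   isomorphic algebras. *)
Definition jform_data (F : fieldType) (n : nat) (V : vectType F)
    (phi : {symmetric V}) : Prop :=
  \dim {:V} = n /\ nondegenerate phi.

Definition jmx (F : fieldType) (n : nat) : Type := 'M[F]_n.

Section MatrixPlus.
Variables (F : fieldType) (n : nat).

HB.instance Definition _ := GRing.Lmodule.copy (jmx F n) 'M[F]_n.

Definition jmx_nmul (X Y : 'M[F]_n) : 'M[F]_n :=
  2%:R^-1 *: (X *m Y + Y *m X).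

Fact jmx_nmulC : commutative jmx_nmul.
Proof. by move=> X Y; rewrite /jmx_nmul addrC. Qed.

Fact jmx_nmulPl (c : F) (X Y Z : 'M[F]_n) :
  jmx_nmul (c *: X + Y) Z = c *: jmx_nmul X Z + jmx_nmul Y Z.
Proof.
rewrite /jmx_nmul mulmxDl mulmxDr -scalemxAl -scalemxAr addrACA.
by rewrite !scalerDr !scalerA mulrC.
Qed.

HB.instance Definition _ :=
  Lmodule_isComNAlgebra.Build F (jmx F n) jmx_nmulC jmx_nmulPl.

End MatrixPlus.

(* H(M_n(F), j) for the transposition j(X) = X^T. *)
Section SymmetricMatrices.
Variables (F : fieldType) (n : nat).

Definition trmx_fixed : {pred jmx F n} := fun X => (X : 'M_n)^T == X.

Fact trmx_fixed_submod : submod_closed trmx_fixed.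
Proof.
split=> [|c X Y /eqP sX /eqP sY]; apply/eqP; first exact: trmx0.
by rewrite linearP /= sX sY.
Qed.
HB.instance Definition _ :=
  GRing.isSubmodClosed.Build F (jmx F n) trmx_fixed trmx_fixed_submod.

Inductive sym_jmx : predArgType := SymJmx X & X \in trmx_fixed.
Definition sym_jmx_val (S : sym_jmx) : jmx F n := let: SymJmx X _ := S in X.
HB.instance Definition _ := [isSub of sym_jmx for sym_jmx_val].
HB.instance Definition _ := [Choice of sym_jmx by <:].
HB.instance Definition _ := [SubChoice_isSubZmodule of sym_jmx by <:].
HB.instance Definition _ := [SubZmodule_isSubLmodule of sym_jmx by <:].

Fact trmx_fixed_nmul (X Y : jmx F n) :
  X \in trmx_fixed -> Y \in trmx_fixed -> X ** Y \in trmx_fixed.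
Proof.
move=> /eqP sX /eqP sY; apply/eqP; rewrite /nmul /= /jmx_nmul.
by rewrite linearZ linearD /= !trmx_mul sX sY addrC.
Qed.

Definition sym_jmx_nmul (S T : sym_jmx) : sym_jmx :=
  SymJmx (trmx_fixed_nmul (valP S) (valP T)).

Fact sym_jmx_nmulC : commutative sym_jmx_nmul.
Proof. by move=> S T; apply/val_inj/nmulC. Qed.

Fact sym_jmx_nmulPl (c : F) (S T U : sym_jmx) :
  sym_jmx_nmul (c *: S + T) U = c *: sym_jmx_nmul S U + sym_jmx_nmul T U.
Proof. by apply/val_inj/nmulPl. Qed.

HB.instance Definition _ :=
  Lmodule_isComNAlgebra.Build F sym_jmx sym_jmx_nmulC sym_jmx_nmulPl.

End SymmetricMatrices.

(* Main.v *)
Require Import Defs.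
From HB Require Import structures.
From mathcomp Require Import all_boot all_algebra.
From mathcomp Require Import ring.
From Stdlib Require ClassicalEpsilon.

(* A is determined by al = (a, b), be = (b, c), ga = (c, a) and ps = (a, bc):
   the fusion rules express a(b(ca)) through shorter words, so the nine words
   a, b, c, ab, bc, ca, a(bc), b(ca), c(ab) span a space stable under the left
   multiplications by a, b, c.  As the Miyamoto involutions
   u |-> u - 4au + 4(a, u)a are automorphisms, this space is a subalgebra.
   Hence two algebras with nondegenerate forms and the same parameters are
   isomorphic, through the span of the pairs of corresponding words in their
   product.

   A model with given parameters is obtained from a 3 x 3 matrix G with unit
   diagonal, G_ij G_ji in {al, be, ga}, and G_12 G_23 G_31, G_13 G_32 G_21 the
   two roots p, q of t^2 - 2 ps t + al be ga.  Factoring G = Y X through its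
   rank r, the rank one idempotents (column i of X)(row i of Y) of M_r have the
   required parameters.  They generate M_r^+ if p <> q.  If p = q, G can be
   chosen symmetric, G = X^T X; the idempotents generate the symmetric matrices
   when two of al, be, ga are nonzero, and otherwise one of them is orthogonal
   to the two others and A splits off a copy of F. *)

Set Implicit Arguments.
Unset Strict Implicit.
Unset Printing Implicit Defensive.

Import GRing.Theory.
Local Open Scope ring_scope.

(** * Axes and Miyamoto involutions *)

Section NAlgebra.
Variables (F : fieldType) (A : comNAlgType F).
Implicit Types x y z : A.

Lemma nmulDl x y z : (x + y) ** z = x ** z + y ** z.
Proof. by rewrite -{1}[x]scale1r nmulPl scale1r. Qed.

Lemma nmul0l z : 0 ** z = 0.
Proof. by apply: (addrI (0 ** z)); rewrite -nmulDl !addr0. Qed.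

Lemma nmulZl k x z : (k *: x) ** z = k *: (x ** z).
Proof. by rewrite -[k *: x]addr0 nmulPl nmul0l !addr0. Qed.

Lemma nmulDr x y z : z ** (x + y) = z ** x + z ** y.
Proof. by rewrite nmulC nmulDl !(nmulC z). Qed.

Lemma nmulZr k x z : z ** (k *: x) = k *: (z ** x).
Proof. by rewrite nmulC nmulZl nmulC. Qed.

Lemma nmul0r z : z ** 0 = 0.
Proof. by rewrite nmulC nmul0l. Qed.

Lemma nmulNl x z : (- x) ** z = - (x ** z).
Proof. by rewrite -scaleN1r nmulZl scaleN1r. Qed.

Lemma nmulNr x z : z ** (- x) = - (z ** x).
Proof. by rewrite nmulC nmulNl nmulC. Qed.

Definition nmulE :=
  (nmulDl, nmulDr, nmulNl, nmulNr, nmulZl, nmulZr, nmul0l, nmul0r).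

End NAlgebra.

Lemma half_fixed0 (F : fieldType) (t : F) :
  2%:R != 0 :> F -> t = 2%:R^-1 * t -> t = 0.
Proof.
move=> two_neq0 /eqP; rewrite -subr_eq0 -{1}[t]mul1r -mulrBl mulf_eq0.
have -> : 1 - 2%:R^-1 = 2%:R^-1 :> F by field.
by rewrite invr_eq0 (negPf two_neq0) => /eqP.
Qed.

Section Axial.
Variables (F : fieldType) (A : comNAlgType F) (f : A -> A -> F).
Implicit Types a b c u v x y z : A.

Record assoc_form : Prop := AssocForm {
  aformPl : forall k x y z, f (k *: x + y) z = k * f x z + f y z;
  aformC : forall x y, f x y = f y x;
  aformA : forall x y z, f (x ** y) z = f x (y ** z);
  form_nondeg : forall x, (forall y, f x y = 0) -> x = 0
}.

(** By primitivity the component of u in the 1-space of a is (a, u)a. The identity [axialM] records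
    the Peirce decomposition in this form, and the fusion rules then speak of the 0-space and the
    1/2-space only. *)
Record axial a : Prop := Axial {
  axial_idem : a ** a = a;
  axial_norm : f a a = 1;
  axialM : forall u, a ** (a ** u) = 2%:R^-1 *: (a ** u + f a u *: a);
  axial00 : forall x y, a ** x = 0 -> a ** y = 0 -> a ** (x ** y) = 0;
  axial0h : forall x y, a ** x = 0 -> a ** y = 2%:R^-1 *: y ->
    a ** (x ** y) = 2%:R^-1 *: (x ** y);
  axialhh : forall x y, a ** x = 2%:R^-1 *: x -> a ** y = 2%:R^-1 *: y ->
    a ** (x ** y) = f a (x ** y) *: a
}.

Hypothesis fP : assoc_form.
Hypothesis two_neq0 : 2%:R != 0 :> F.
Let four_neq0 : 4%:R != 0 :> F.
Proof. by rewrite -[4%N]/(2 * 2)%N natrM mulf_neq0. Qed.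

Lemma aformDl x y z : f (x + y) z = f x z + f y z.
Proof. by rewrite -{1}[x]scale1r aformPl // mul1r. Qed.

Lemma aform0l z : f 0 z = 0.
Proof. by apply: (addrI (f 0 z)); rewrite -aformDl !addr0. Qed.

Lemma aformZl k x z : f (k *: x) z = k * f x z.
Proof. by rewrite -[k *: x]addr0 aformPl // aform0l addr0. Qed.

Lemma aformNl x z : f (- x) z = - f x z.
Proof. by rewrite -scaleN1r aformZl mulN1r. Qed.

Lemma aformDr x y z : f z (x + y) = f z x + f z y.
Proof. by rewrite !(aformC fP z) aformDl. Qed.

Lemma aformZr k x z : f z (k *: x) = k * f z x.
Proof. by rewrite !(aformC fP z) aformZl. Qed.

Lemma aformNr x z : f z (- x) = - f z x.
Proof. by rewrite !(aformC fP z) aformNl. Qed.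

Lemma aform0r z : f z 0 = 0.
Proof. by rewrite aformC // aform0l. Qed.

Definition aformE := (aformDl, aformDr, aformNl, aformNr, aformZl, aformZr,
  aform0l, aform0r).

Lemma form_ext x y : (forall z, f x z = f y z) -> x = y.
Proof.
move=> e; apply/eqP; rewrite -subr_eq0; apply/eqP/(form_nondeg fP) => z.
by rewrite !aformE e subrr.
Qed.

(* The form is nondegenerate, so that identities between vectors can be checked
   by [field] after pairing with an arbitrary vector. *)
Ltac lin := apply: form_ext => ?; rewrite !aformE; field;
  rewrite ?two_neq0 ?four_neq0 //.

Lemma half_form0 a u : axial a -> a ** u = 2%:R^-1 *: u -> f a u = 0.
Proof.
move=> aP e; apply: half_fixed0 => //.
by rewrite -{1}(axial_idem aP) aformA // e aformZr.
Qed.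

Lemma null_form0 a u : axial a -> a ** u = 0 -> f a u = 0.
Proof. by move=> aP e; rewrite -(axial_idem aP) aformA // e aform0r. Qed.

(** This is half of the component of u in the 1/2-space of a, whence the factors 2 in [peirce0] and
    [peirceE]. *)
Definition peirce_half a u := a ** u - f a u *: a.
Definition peirce0 a u := u - 2%:R *: peirce_half a u - f a u *: a.

Lemma peirce_halfM a u : axial a ->
  a ** peirce_half a u = 2%:R^-1 *: peirce_half a u.
Proof. move=> aP; rewrite /peirce_half !nmulE axialM // axial_idem //; lin. Qed.

Lemma peirce0M a u : axial a -> a ** peirce0 a u = 0.
Proof.
move=> aP; have h := peirce_halfM u aP.
have e : a ** u = peirce_half a u + f a u *: a by rewrite /peirce_half; lin.
rewrite /peirce0; move: (peirce_half a u) h e => y h e.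
rewrite !nmulE h e axial_idem //; lin.
Qed.

Lemma peirceE a u : u = peirce0 a u + 2%:R *: peirce_half a u + f a u *: a.
Proof. rewrite /peirce0; lin. Qed.

(* Write b = u + 2y + al a and c = v + 2x + ga a, with u, v in the 0-space and
   x, y in the 1/2-space of a.  Then bc, b(ca) and c(ab) are combinations of uv,
   ux, vy, xy and of a, x, y; the fusion rules give the action of a on each, and
   the three products determine ux. *)
Lemma axial_triple a b c : axial a ->
  a ** (b ** (c ** a)) =
  4%:R^-1 *: (a ** (b ** c) + b ** (c ** a) - c ** (a ** b)
     + f c a *: (a ** b) + f a b *: (c ** a) + f a (b ** c) *: a).
Proof.
move=> aP; rewrite ![_ ** a]nmulC (aformC fP c a).
have [xh yh] := (peirce_halfM c aP, peirce_halfM b aP).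
have [b0 c0] := (peirce0M b aP, peirce0M c aP).
have [eb ec] := (peirceE a b, peirceE a c).
set x := peirce_half a c in xh ec; set y := peirce_half a b in yh eb.
set u := peirce0 a b in b0 eb; set v := peirce0 a c in c0 ec.
have acE : a ** c = x + f a c *: a by rewrite /x /peirce_half; lin.
have abE : a ** b = y + f a b *: a by rewrite /y /peirce_half; lin.
move: (f a b) (f a c) x y u v xh yh b0 c0 eb ec acE abE.
move=> al ga x y u v xh yh b0 c0 eb ec acE abE.
have P := axial00 aP b0 c0; have Q := axial0h aP b0 xh.
have R := axial0h aP c0 yh; have Z := axialhh aP xh yh.
have f0 := (null_form0 aP P, half_form0 aP Q, half_form0 aP R, half_form0 aP xh,
  half_form0 aP yh, axial_norm aP).
have E1 : b ** (a ** c) = u ** x + 2%:R *: (x ** y) + (2%:R^-1 * al) *: x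
    + ga *: (y + al *: a).
  rewrite acE nmulE nmulZr (nmulC b a) abE {1}eb !nmulE xh [y ** x]nmulC; lin.
have E2 : c ** (a ** b) = v ** y + 2%:R *: (x ** y) + (2%:R^-1 * ga) *: y
    + al *: (x + ga *: a).
  rewrite abE nmulE nmulZr (nmulC c a) acE {1}ec !nmulE yh; lin.
have E3 : b ** c = u ** v + 2%:R *: (u ** x) + 2%:R *: (v ** y)
    + 4%:R *: (x ** y) + al *: x + ga *: y + (al * ga) *: a.
  rewrite eb ec !nmulE ![_ ** a]nmulC xh yh b0 c0 axial_idem // [y ** x]nmulC
    [y ** v]nmulC; lin.
rewrite E1 E2 E3 acE abE !nmulE P Q R Z xh yh axial_idem // !aformE !f0.
lin.
Qed.

(** The involution that is -1 on the 1/2-space of a and the identity on the 0-space and on a. *)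
Definition miyamoto a u := u - 4%:R *: (a ** u) + (4%:R * f a u) *: a.

Lemma miyamotoP a k u v :
  miyamoto a (k *: u + v) = k *: miyamoto a u + miyamoto a v.
Proof. rewrite /miyamoto !nmulE; lin. Qed.

Lemma miyamoto_fixed a u : a ** u = f a u *: a -> miyamoto a u = u.
Proof. move=> e; rewrite /miyamoto e; lin. Qed.

Lemma miyamoto_half a u : axial a -> a ** u = 2%:R^-1 *: u ->
  miyamoto a u = - u.
Proof. move=> aP e; rewrite /miyamoto e (half_form0 aP e); lin. Qed.

Lemma miyamotoE a u : axial a ->
  miyamoto a u = peirce0 a u - 2%:R *: peirce_half a u + f a u *: a.
Proof. move=> aP; rewrite /miyamoto /peirce0 /peirce_half; lin. Qed.

(** The fusion rules make A graded by Z/2, the even part being the 0-space plus the line of a, and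
    the odd part the 1/2-space. Negating the odd part is therefore multiplicative. *)
Lemma miyamotoM a u v : axial a ->
  miyamoto a (u ** v) = miyamoto a u ** miyamoto a v.
Proof.
move=> aP; rewrite [miyamoto a u]miyamotoE // [miyamoto a v]miyamotoE //.
rewrite {1}(peirceE a u) {1}(peirceE a v).
have [xh yh] := (peirce_halfM u aP, peirce_halfM v aP).
have [x0 y0] := (peirce0M u aP, peirce0M v aP).
move: (f a u) (f a v) (peirce0 a u) (peirce0 a v) xh yh x0 y0.
move: (peirce_half a u) (peirce_half a v) => x y k l w z xh yh x0 y0.
have t00 : miyamoto a (w ** z) = w ** z.
  have e := axial00 aP x0 y0.
  by rewrite miyamoto_fixed // e (null_form0 aP e) scale0r.
have t0h : miyamoto a (w ** y) = - (w ** y).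
  exact/miyamoto_half/axial0h.
have th0 : miyamoto a (z ** x) = - (z ** x).
  exact/miyamoto_half/axial0h.
have thh : miyamoto a (x ** y) = x ** y.
  exact/miyamoto_fixed/axialhh.
have th1 := miyamoto_half aP xh; have th2 := miyamoto_half aP yh.
have t1 : miyamoto a a = a.
  by rewrite miyamoto_fixed // axial_idem // axial_norm // scale1r.
rewrite !nmulE ![_ ** a]nmulC [x ** z]nmulC xh yh x0 y0 axial_idem //.
have tD p q : miyamoto a (p + q) = miyamoto a p + miyamoto a q.
  by rewrite -{1}[p]scale1r miyamotoP scale1r.
have t0 : miyamoto a 0 = 0 by rewrite /miyamoto !nmulE; lin.
have tZ r p : miyamoto a (r *: p) = r *: miyamoto a p.
  by rewrite -[r *: p]addr0 miyamotoP t0 addr0.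
rewrite !(tD, tZ, t0) t00 t0h th0 thh th1 th2 t1; lin.
Qed.

Lemma miyamotoK a u : axial a -> miyamoto a (miyamoto a u) = u.
Proof.
move=> aP; rewrite /miyamoto !nmulE !aformE axialM // axial_idem //.
have -> : f a (a ** u) = f a u by rewrite -aformA // axial_idem.
rewrite axial_norm //; lin.
Qed.

End Axial.

(** * Three generating axes and the nine words in them *)

Record triad (F : fieldType) (A : comNAlgType F) (f : A -> A -> F) (a b c : A)
    (al be ga ps : F) : Prop := Triad {
  triad_form : assoc_form f;
  triad_a : axial f a;
  triad_b : axial f b;
  triad_c : axial f c;
  triad_gen : generates (fun x => [\/ x = a, x = b | x = c]);
  triad_ab : f a b = al;
  triad_bc : f b c = be;
  triad_ca : f c a = ga;
  triad_abc : f a (b ** c) = ps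
}.

Section TriadWords.
Variables (F : fieldType) (A : comNAlgType F) (f : A -> A -> F) (a b c : A).
Variables (al be ga ps : F).
Hypothesis two_neq0 : 2%:R != 0 :> F.
Hypothesis tP : triad f a b c al be ga ps.
Let fP := triad_form tP.

(** Associativity makes (a, bc) invariant under permutations of the axes. Statements proved for a
    thus pass to b and c by rotation. *)
Lemma triad_cycle : triad f b c a be ga al ps.
Proof.
case: tP => _ aP bP cP gen ab bc ca abc; split=> //; last first.
  by rewrite -aformA // aformC.
by move=> S sS h; apply: gen => // x [] ->; apply: h;
  [apply: Or33|apply: Or31|apply: Or32].
Qed.

Lemma triad_flip : triad f c b a be al ga ps.
Proof.
case: tP => _ aP bP cP gen ab bc ca abc; split=> //;
  try by rewrite aformC.
  by move=> S sS h; apply: gen => // x [] ->; apply: h;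
    [apply: Or33|apply: Or32|apply: Or31].
by rewrite -aformA // aformC // [c ** b]nmulC.
Qed.

(** The product of types serves as one rewriting multirule. The values on b(ca) and c(ab) come from
    (b, a(ac)) and (c, a(ab)), where [axialM] removes a repeated factor a. *)
Lemma triad_form_words :
  (f a b = al) * (f a c = ga) * (f a (a ** b) = al) * (f a (c ** a) = ga)
  * (f a (a ** (b ** c)) = ps)
  * (f a (b ** (c ** a)) = 2%:R^-1 * (ps + al * ga))
  * (f a (c ** (a ** b)) = 2%:R^-1 * (ps + al * ga)).
Proof.
case: tP => _ aP bP cP gen ab bc ca abc.
have faM u : f a (a ** u) = f a u by rewrite -aformA // (axial_idem aP).
have ac : f a c = ga by rewrite aformC.
have fb : f b (a ** c) = ps by rewrite -aformA // [b ** a]nmulC aformA.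
have fc : f c (a ** b) = ps by rewrite aformC // aformA.
rewrite !faM [c ** a]nmulC faM; do ![split=> //].
  rewrite -aformA // [a ** b]nmulC aformA // (axialM aP).
  by rewrite aformZr // aformDr // aformZr // fb ac [f b a]aformC // ab [al *
    _]mulrC.
rewrite -aformA // [a ** c]nmulC aformA // (axialM aP).
by rewrite aformZr // aformDr // aformZr // fc ca ab.
Qed.

(** As ab, ac = ca and a(bc) are words themselves, these six products complete the action of a on
    the nine words. *)
Lemma triad_mul_words :
  (a ** a = a) * (a ** (a ** b) = 2%:R^-1 *: (a ** b + al *: a))
  * (a ** (c ** a) = 2%:R^-1 *: (c ** a + ga *: a))
  * (a ** (a ** (b ** c)) = 2%:R^-1 *: (a ** (b ** c) + ps *: a))
  * (a ** (b ** (c ** a)) = 4%:R^-1 *: (a ** (b ** c) + b ** (c ** a)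
       - c ** (a ** b) + ga *: (a ** b) + al *: (c ** a) + ps *: a))
  * (a ** (c ** (a ** b)) = 4%:R^-1 *: (a ** (b ** c) + c ** (a ** b)
       - b ** (c ** a) + al *: (c ** a) + ga *: (a ** b) + ps *: a)).
Proof.
have fw := triad_form_words; case: tP => _ aP bP cP gen ab bc ca abc.
do ![split].
- exact: (axial_idem aP).
- by rewrite (axialM aP) ab.
- by rewrite [c ** a]nmulC (axialM aP) fw.
- by rewrite (axialM aP) abc.
- by rewrite (axial_triple fP) // ca ab abc.
rewrite [a ** b]nmulC (axial_triple fP) // [f b a]aformC // !fw.
by rewrite [c ** b]nmulC abc [a ** c]nmulC.
Qed.

End TriadWords.

(** * The isomorphism determined by the parameters *)

(** A linear relation and not a map, because the words may be linearly dependent. That it is single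
    valued follows later from nondegeneracy. *)
Inductive word_span (F : fieldType) (A T : comNAlgType F) (a b c : A)
    (a' b' c' : T) : A -> T -> Prop :=
| WordSpan0 : word_span a b c a' b' c' 0 0
| WordSpanP k x x' y y' : word_span a b c a' b' c' x x' ->
    word_span a b c a' b' c' y y' ->
    word_span a b c a' b' c' (k *: x + y) (k *: x' + y')
| WordA : word_span a b c a' b' c' a a'
| WordB : word_span a b c a' b' c' b b'
| WordC : word_span a b c a' b' c' c c'
| WordAB : word_span a b c a' b' c' (a ** b) (a' ** b')
| WordBC : word_span a b c a' b' c' (b ** c) (b' ** c')
| WordCA : word_span a b c a' b' c' (c ** a) (c' ** a')
| WordABC : word_span a b c a' b' c' (a ** (b ** c)) (a' ** (b' ** c'))
| WordBCA : word_span a b c a' b' c' (b ** (c ** a)) (b' ** (c' ** a'))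
| WordCAB : word_span a b c a' b' c' (c ** (a ** b)) (c' ** (a' ** b')).

Section WordSpan.
Variables (F : fieldType) (A T : comNAlgType F).

Lemma word_span_cycle (a b c x : A) (a' b' c' x' : T) :
  word_span b c a b' c' a' x x' -> word_span a b c a' b' c' x x'.
Proof. by elim=> *; solve [constructor | exact: WordSpanP]. Qed.

Section Linear.
Variables (a b c : A) (a' b' c' : T).
Local Notation W := (word_span a b c a' b' c').

Lemma word_spanD x x' y y' : W x x' -> W y y' -> W (x + y) (x' + y').
Proof. by move=> Wx Wy; rewrite -[x]scale1r -[x']scale1r; apply: WordSpanP. Qed.

Lemma word_spanZ k x x' : W x x' -> W (k *: x) (k *: x').
Proof.
by move=> Wx; rewrite -[k *: x]addr0 -[k *: x']addr0;
  apply: WordSpanP Wx (WordSpan0 _ _ _ _ _ _).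
Qed.

Lemma word_spanB x x' y y' : W x x' -> W y y' -> W (x - y) (x' - y').
Proof.
move=> Wx Wy; rewrite -scaleN1r -[- y']scaleN1r.
exact: word_spanD Wx (word_spanZ _ Wy).
Qed.

End Linear.

Variables (f : A -> A -> F) (g : T -> T -> F).
Hypothesis two_neq0 : 2%:R != 0 :> F.

Section Left.
Variables (a b c : A) (a' b' c' : T) (al be ga ps : F).
Hypotheses (tP : triad f a b c al be ga ps) (tP' : triad g a' b' c' al be ga
  ps).
Local Notation W := (word_span a b c a' b' c').

Lemma word_span_forml x x' : W x x' -> f a x = g a' x'.
Proof.
have [fP gP] := (triad_form tP, triad_form tP').
elim=> [|k y y' z z' _ IHy _ IHz|||||||||];
  rewrite ?(triad_form_words tP) ?(triad_form_words tP') //.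
- by rewrite aform0r // aform0r.
- by rewrite aformDr // aformZr // aformDr // aformZr // IHy IHz.
- by rewrite (axial_norm (triad_a tP)) (axial_norm (triad_a tP')).
- by rewrite (triad_abc tP) (triad_abc tP').
Qed.

Lemma word_span_mull x x' : W x x' -> W (a ** x) (a' ** x').
Proof.
elim=> [|k y y' z z' _ IHy _ IHz|||||||||];
  rewrite ?(triad_mul_words two_neq0 tP) ?(triad_mul_words two_neq0 tP');
  rewrite ?nmulE;
  try by do ?[constructor|apply: word_spanB|apply: word_spanD|apply:
    word_spanZ].
(* Only the word c is left: ac is the word ca up to commutativity. *)
by rewrite nmulC [_ ** c']nmulC; constructor.
Qed.

Lemma word_span_miyamoto x x' : W x x' -> W (miyamoto f a x) (miyamoto g a' x').
Proof.
move=> Wx; rewrite /miyamoto (word_span_forml Wx).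
apply: word_spanD; last by apply: word_spanZ; constructor.
by apply: word_spanB => //; apply/word_spanZ/word_span_mull.
Qed.

(* Conjugation by the automorphism miyamoto a turns the multiplication by x into
   that by miyamoto a x, so the multipliers are stable under miyamoto a, hence
   under the multiplication by a. *)
Definition multiplier x x' :=
  W x x' /\ forall u u', W u u' -> W (x ** u) (x' ** u').

Lemma multiplierP k x x' y y' : multiplier x x' -> multiplier y y' ->
  multiplier (k *: x + y) (k *: x' + y').
Proof.
move=> [Wx Mx] [Wy My]; split=> [|u u' Wu]; first exact: WordSpanP.
by rewrite !nmulPl; apply: WordSpanP; [apply: Mx | apply: My].
Qed.

Lemma multiplier_miyamoto x x' : multiplier x x' ->
  multiplier (miyamoto f a x) (miyamoto g a' x').
Proof.
move=> [Wx Mx]; split=> [|u u' Wu]; first exact: word_span_miyamoto.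
have [fP gP] := (triad_form tP, triad_form tP').
have [aP aP'] := (triad_a tP, triad_a tP').
rewrite -(miyamotoK fP two_neq0 u aP) -(miyamotoK gP two_neq0 u' aP')
  -!miyamotoM //.
exact/word_span_miyamoto/Mx/word_span_miyamoto.
Qed.

Lemma multiplier_left : multiplier a a'.
Proof. by split; [constructor | exact: word_span_mull]. Qed.

Lemma multiplier_mull x x' : multiplier x x' -> multiplier (a ** x) (a' ** x').
Proof.
move=> Mx; have Mt := multiplier_miyamoto Mx.
have four_neq0 : 4%:R != 0 :> F.
  by rewrite -[4%N]/(2 * 2)%N natrM mulf_neq0.
(* The definition of [miyamoto] solved for the product of p and y. The final 0 gives the nested
   shape k x + y that [multiplierP] expects. *)
have mulE (B : comNAlgType F) (h : B -> B -> F) (p y : B) :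
    p ** y = (- 4%:R^-1) *: miyamoto h p y + (4%:R^-1 *: y + (h p y *: p + 0)).
  have K (z : B) : 4%:R^-1 *: (4%:R *: z) = z by rewrite scalerA mulVf //
    scale1r.
  rewrite /miyamoto addr0 scaleNr -scalerA scalerDr scalerBr !K opprD opprB.
  by rewrite addrACA subrK addNr addr0.
rewrite (mulE _ f a x) (mulE _ g a' x') (word_span_forml Mx.1).
have M0 : multiplier 0 0.
  by split=> [|u u' _]; rewrite ?nmul0l; apply: WordSpan0.
do ?apply: multiplierP => //; exact: multiplier_left.
Qed.

End Left.

Lemma multiplier_cycle (a b c x : A) (a' b' c' x' : T) :
  multiplier b c a b' c' a' x x' -> multiplier a b c a' b' c' x x'.
Proof.
case=> Wx Mx; split=> [|u u' Wu]; first exact: word_span_cycle.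
by apply/word_span_cycle/Mx; do 2!apply: word_span_cycle.
Qed.

Section Iso.
Variables (a b c : A) (a' b' c' : T) (al be ga ps : F).
Hypotheses (tP : triad f a b c al be ga ps) (tP' : triad g a' b' c' al be ga
  ps).
Local Notation W := (word_span a b c a' b' c').
Local Notation M := (multiplier a b c a' b' c').

Let tB := triad_cycle tP.
Let tB' := triad_cycle tP'.
Let tC := triad_cycle tB.
Let tC' := triad_cycle tB'.

Let MA x x' : M x x' -> M (a ** x) (a' ** x').
Proof. exact: multiplier_mull tP tP' _ _. Qed.

Let MB x x' : M x x' -> M (b ** x) (b' ** x').
Proof.
move=> Mx; apply: multiplier_cycle; apply: (multiplier_mull tB tB').
by do 2!apply: multiplier_cycle.
Qed.

Let MC x x' : M x x' -> M (c ** x) (c' ** x').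
Proof.
move=> Mx; do 2!apply: multiplier_cycle; apply: (multiplier_mull tC tC').
exact: multiplier_cycle.
Qed.

(** Each word arises from a generator by multiplication by generators, which preserves multipliers
    by [MA], [MB] and [MC]. *)
Lemma word_span_multiplier x x' : W x x' -> M x x'.
Proof.
have Ma : M a a' by apply: multiplier_left tP tP'.
have Mb : M b b' by apply/multiplier_cycle/(multiplier_left tB tB').
have Mc : M c c' by do 2!apply: multiplier_cycle; apply: multiplier_left tC tC'.
elim=> [|k y y' z z' _ My _ Mz|||||||||] //;
  do ?[exact: MA|exact: MB|exact: MC].
- by split=> [|u u' _]; rewrite ?nmul0l; constructor.
- exact: multiplierP.
- exact/MA/MB.
- exact/MB/MC.
- exact/MC/MA.
Qed.

Lemma word_spanM x x' y y' : W x x' -> W y y' -> W (x ** y) (x' ** y').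
Proof. by move=> /word_span_multiplier[_ Mx]; apply: Mx. Qed.

(** Associativity splits off the leading generator of a word, as in (a(bc), y) = (a, (bc)y), and
    reduces the claim to pairings with a generator. *)
Lemma word_span_form x x' y y' : W x x' -> W y y' -> f x y = g x' y'.
Proof.
have [fP gP] := (triad_form tP, triad_form tP').
have Fa u u' : W u u' -> f a u = g a' u' by apply: word_span_forml tP tP' _ _.
have Fb u u' : W u u' -> f b u = g b' u'.
  by move=> Wu; apply: (word_span_forml tB tB'); do 2!apply: word_span_cycle.
have Fc u u' : W u u' -> f c u = g c' u'.
  by move=> Wu; apply: (word_span_forml tC tC'); apply: word_span_cycle.
have [Wa Wb Wc] : [/\ W a a', W b b' & W c c'] by split; constructor.
move=> Wx; elim: Wx y y' => [|k p p' q q' _ IHp _ IHq|||||||||] y y' Wy.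
- by rewrite !aform0l.
- by rewrite !aformPl // (IHp _ _ Wy) (IHq _ _ Wy).
- exact: Fa.
- exact: Fb.
- exact: Fc.
- by rewrite !aformA //; apply/Fa/word_spanM.
- by rewrite !aformA //; apply/Fb/word_spanM.
- by rewrite !aformA //; apply/Fc/word_spanM.
- by rewrite !aformA //; apply/Fa/word_spanM => //; apply: word_spanM.
- by rewrite !aformA //; apply/Fb/word_spanM => //; apply: word_spanM.
- by rewrite !aformA //; apply/Fc/word_spanM => //; apply: word_spanM.
Qed.

(** The domain of the relation is a subalgebra that contains the generators. *)
Lemma word_span_total x : exists x', W x x'.
Proof.
have := triad_gen tP (S := fun y => exists y', W y y'); apply=> [|y [] ->].
- split=> [|k y z [y' Wy] [z' Wz]|y z [y' Wy] [z' Wz]].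
  + by exists 0; constructor.
  + by exists (k *: y' + z'); constructor.
  + by exists (y' ** z'); apply: word_spanM.
- by exists a'; constructor.
- by exists b'; constructor.
- by exists c'; constructor.
Qed.

Lemma word_span_surj x' : exists x, W x x'.
Proof.
have := triad_gen tP' (S := fun y' => exists y, W y y'); apply=> [|y [] ->].
- split=> [|k y z [y' Wy] [z' Wz]|y z [y' Wy] [z' Wz]].
  + by exists 0; constructor.
  + by exists (k *: y' + z'); constructor.
  + by exists (y' ** z'); apply: word_spanM.
- by exists a; constructor.
- by exists b; constructor.
- by exists c; constructor.
Qed.

(** The difference y' - z' is related to 0. Every element of [T] is related to some element of [A]
    and the relation preserves the forms, so y' - z' is orthogonal to all of [T]. *)
Lemma word_span_fun x y' z' : W x y' -> W x z' -> y' = z'.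
Proof.
move=> Wy Wz; apply/eqP; rewrite -subr_eq0; apply/eqP.
apply: (form_nondeg (triad_form tP')) => v'.
have [v Wv] := word_span_surj v'.
rewrite -(word_span_form (word_spanB Wy Wz) Wv) subrr aform0l //.
exact: triad_form tP.
Qed.

Lemma word_span_inj x y z' : W x z' -> W y z' -> x = y.
Proof.
move=> Wx Wy; apply/eqP; rewrite -subr_eq0; apply/eqP.
apply: (form_nondeg (triad_form tP)) => v.
have [v' Wv] := word_span_total v.
rewrite (word_span_form (word_spanB Wx Wy) Wv) subrr aform0l //.
exact: triad_form tP'.
Qed.

Lemma triad_iso : alg_iso A T.
Proof.
(* The relation is a bijection; choosing its values in both directions turns it into a map with an
   inverse. *)
have ch := ClassicalEpsilon.constructive_indefinite_description.
pose h x := sval (ch _ _ (word_span_total x)).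
have hP x : W x (h x) by exact: (svalP (ch _ _ _)).
pose k x := sval (ch _ _ (word_span_surj x)).
have kP x : W (k x) x by rewrite /k; case: (ch _ _ (word_span_surj x)).
have h_lin : linear h.
  by move=> r x y; apply: (word_span_fun (hP _)); apply: WordSpanP.
pose hL := GRing.isLinear.Build F A T _ h h_lin.
exists (HB.pack h hL : {linear A -> T}); split=> [|x y].
  exists k => x; first exact: word_span_inj (kP _) (hP _).
  exact: word_span_fun (hP _) (kP _).
by apply: (word_span_fun (hP _)); apply: word_spanM.
Qed.

End Iso.
End WordSpan.

(** * Axes in terms of the normalized Frobenius form *)

Section AxisAxial.
Variables (F : fieldType) (A : comNAlgType F) (B : {symmetric A}).
Hypothesis two_neq0 : 2%:R != 0 :> F.
Hypothesis BP : normalized_frobenius_form B.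
Hypothesis B_nondeg : forall x : A, in_radical B x -> x = 0.

Lemma frobenius_assoc_form : assoc_form (fun x y => B x y).
Proof.
have BC x y : B x y = B y x by rewrite hermitian_subproof expr0 mul1r.
have [[_ BA _] _] := BP; split=> //.
- by move=> k x y z; rewrite linearPl.
- by move=> x y z; rewrite nmulC BA BC nmulC.
Qed.

Let fP := frobenius_assoc_form.

Lemma axis_axial a : axis a -> axial (fun x y => B x y) a.
Proof.
move=> aP; have Ba : B a a = 1 by case: BP => _; apply.
case: aP => aa [w [w1 w_neq0 wP]] peirce [[F0h F1h] _ [F00 _] Fhh].
(* Primitivity: a and u are both multiples of w, so u is a multiple of a, and pairing with a gives
   the factor. *)
have a1 u : a ** u = u -> u = B a u *: a.
  move=> au; have a_neq0 : a != 0.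
    by apply: contra_eqN (Ba) => /eqP ->; rewrite linear0l eq_sym oner_eq0.
  have [r ar] : exists r, a = r *: w by apply/wP; rewrite /eigen scale1r.
  have [s us] : exists s, u = s *: w by apply/wP; rewrite /eigen scale1r.
  have r_neq0 : r != 0 by apply: contraNneq a_neq0 => r0; rewrite ar r0 scale0r.
  have e : u = (s / r) *: a by rewrite ar scalerA mulfVK.
  by rewrite {2}e linearZr /= Ba mulr1.
have B0 z : a ** z = 0 -> B a z = 0.
  by move=> e; rewrite -{1}aa (aformA fP) e linear0r.
have Bh z : a ** z = 2%:R^-1 *: z -> B a z = 0.
  move=> e; apply: half_fixed0 => //.
  by rewrite -{1}aa (aformA fP) e linearZr.
split=> //.
- move=> u; have [[[u0 u1] uh] [[/= e0 e1 eh eu] _]] := peirce u.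
  rewrite /eigen scale0r scale1r in e0 e1 eh.
  rewrite eu !nmulE e0 e1 eh !nmulE e1 eh !linearDr /= (B0 _ e0) (Bh _ eh).
  rewrite !add0r addr0 -(a1 _ e1) !scalerDr addrAC -scalerDl.
  have -> : 2%:R^-1 + 2%:R^-1 = 1 :> F by field.
  by rewrite scale1r.
- move=> x y ax ay; have := F00 x y.
  by rewrite /eigen !scale0r; apply.
- move=> x y ax ay; apply: F0h => //.
  by rewrite /eigen scale0r.
- move=> x y ax ay; have [z0 [z1 []]] := Fhh x y ax ay.
  rewrite /eigen scale0r scale1r => e0 e1 ->.
  by rewrite nmulE e0 e1 linearDr /= (B0 _ e0) !add0r -(a1 _ e1).
Qed.

Lemma axis_triad a b c : axis a -> axis b -> axis c ->
  generates (fun x => [\/ x = a, x = b | x = c]) ->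
  triad (fun x y => B x y) a b c (B a b) (B b c) (B c a) (B a (b ** c)).
Proof. by move=> aP bP cP gen; split=> //; apply: axis_axial. Qed.

End AxisAxial.

(** * Models *)

(** Here the 1/2-space is 0: if ay = y/2, then y = 2(a, y)a, and pairing with a gives (a, y) = 2(a,
    y), so (a, y) = 0. *)
Lemma scalar_axial (F : fieldType) (A : comNAlgType F) (f : A -> A -> F) (a :
  A) :
  2%:R != 0 :> F -> assoc_form f ->
  f a a = 1 -> (forall u, a ** u = f a u *: a) -> axial f a.
Proof.
move=> two_neq0 fP faa aE.
have aa : a ** a = a by rewrite aE faa scale1r.
have half y : a ** y = 2%:R^-1 *: y -> y = 0.
  move=> e; have y2 : y = (2%:R * f a y) *: a.
    by rewrite -scalerA -aE e scalerA mulfV // scale1r.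
  have: f a y = 2%:R * f a y by rewrite {1}y2 aformZr // faa mulr1.
  move/eqP; rewrite eq_sym -subr_eq0 -{2}[f a y]mul1r -mulrBl.
  have -> : 2%:R - 1 = 1 :> F by ring.
  by rewrite mul1r => /eqP fy; rewrite y2 fy mulr0 scale0r.
split=> //.
- move=> u; rewrite [a ** u]aE nmulE aa -scalerDl scalerA; congr (_ *: _);
  field.
  by rewrite two_neq0.
- by move=> x y ax _; rewrite aE -aformA // ax aform0l // scale0r.
- by move=> x y _ /half ->; rewrite !nmulE scaler0.
Qed.

(** * Forms and axes of direct sums *)

Section PairAxial.
Variables (F : fieldType) (A T : comNAlgType F).
Variables (f : A -> A -> F) (g : T -> T -> F).
Hypotheses (fP : assoc_form f) (gP : assoc_form g).

Definition pair_form (x y : A * T) : F := f x.1 y.1 + g x.2 y.2.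

Lemma pair_assoc_form : assoc_form pair_form.
Proof.
split; rewrite /pair_form.
- by move=> k x y z /=; rewrite !aformPl // mulrDr addrACA.
- by move=> x y; rewrite aformC // [g _ _]aformC.
- by move=> x y z /=; rewrite !aformA.
move=> [x y] h; congr pair.
  apply: (form_nondeg fP) => z; have := h (z, 0).
  by rewrite /= aform0r // addr0.
apply: (form_nondeg gP) => z; have := h (0, z).
by rewrite /= aform0r // add0r.
Qed.

Lemma pair_axialr a : axial g a -> axial pair_form (0, a).
Proof.
move=> aP.
have pE (x y : A * T) : x ** y = (x.1 ** y.1, x.2 ** y.2) by [].
have sE k (x y : A * T) : k *: x = (k *: x.1, k *: x.2) by [].
split.
- by rewrite pE /= nmul0l (axial_idem aP).
- by rewrite /pair_form /= aform0l // add0r (axial_norm aP).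
- move=> [u v]; rewrite !pE /= !nmul0l (axialM aP) /pair_form /= aform0l //
  add0r.
  by congr pair => /=; rewrite scaler0 addr0 scaler0.
- move=> [u v] [u' v']; rewrite !pE /= !nmul0l => -[h] [h'].
  by congr pair; apply: (axial00 aP).
- move=> [u v] [u' v']; rewrite !pE /= !nmul0l => -[h] [e h'].
  congr pair => /=; first by rewrite -nmulZr -e nmul0r.
  exact: (axial0h aP).
- move=> [u v] [u' v']; rewrite !pE /= !nmul0l => -[_ h] [e h'].
  rewrite /pair_form /= aform0l // add0r (axialhh aP) //.
  by congr pair; rewrite /= scaler0.
Qed.

End PairAxial.

(** * Rank one idempotents under the trace form *)

Section Special.
Variables (F : fieldType) (n : nat).
Hypothesis two_neq0 : 2%:R != 0 :> F.

Section Representation.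
Variables (T : comNAlgType F) (iota : T -> 'M[F]_n).

Definition trace_form x y : F := \tr (iota x *m iota y).

(** This treats the full and the symmetric matrices at once. Nondegeneracy of the trace form also
    makes [iota] injective. *)
Record special_rep : Prop := SpecialRep {
  special_linear : forall k x y, iota (k *: x + y) = k *: iota x + iota y;
  special_mul : forall x y,
    iota (x ** y) = 2%:R^-1 *: (iota x *m iota y + iota y *m iota x);
  special_nondeg : forall x, (forall y, trace_form x y = 0) -> x = 0
}.

Hypothesis rP : special_rep.

Lemma special_inj : injective iota.
Proof.
move=> x y e; apply/eqP; rewrite -subr_eq0; apply/eqP.
rewrite -scaleN1r addrC; apply: (special_nondeg rP) => z.
by rewrite /trace_form (special_linear rP) e scaleN1r addNr mul0mx mxtrace0.
Qed.

Lemma trace_assoc_form : assoc_form trace_form.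
Proof.
split; rewrite /trace_form; last exact: special_nondeg rP.
- by move=> k x y z; rewrite (special_linear rP) mulmxDl -scalemxAl linearP.
- by move=> x y; rewrite mxtrace_mulC.
move=> x y z; rewrite !(special_mul rP).
rewrite -scalemxAl -scalemxAr !linearZ /= mulmxDl mulmxDr !mxtraceD !mulmxA.
by congr (_ * (_ + _)); rewrite -mulmxA mxtrace_mulC.
Qed.

(** A rank one idempotent e = uv satisfies eXe = tr(eX)e, which gives [axialM]. Multiplying the
    eigenvector equations by e or by another factor gives the fusion rules. *)
Lemma special_axial (a : T) (u : 'cV[F]_n) (v : 'rV[F]_n) :
  iota a = u *m v -> v *m u = 1%:M -> axial trace_form a.
Proof.
move=> ia vu; set e : 'M_n := u *m v in ia.
have ee : e *m e = e by rewrite /e mulmxA -(mulmxA u) vu mulmx1.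
have eXe X : e *m X *m e = \tr (e *m X) *: e.
  have -> : e *m X *m e = u *m (v *m X *m u) *m v by rewrite /e !mulmxA.
  have -> : \tr (e *m X) = \tr (v *m X *m u) by rewrite /e -mulmxA mxtrace_mulC.
  move: (v *m X *m u) => w.
  by rewrite {1}[w]mx11_scalar mul_mx_scalar -scalemxAl trace_mx11.
have tr_e : \tr e = 1 by rewrite /e mxtrace_mulC vu mxtrace1.
clearbody e.
have iz := special_inj.
have i0 : iota 0 = 0.
  by rewrite -[0 : T](addNr 0) -scaleN1r (special_linear rP) scaleN1r addNr.
have iZ k x : iota (k *: x) = k *: iota x.
  by rewrite -[k *: x]addr0 (special_linear rP) i0 addr0.
have iD x y : iota (x + y) = iota x + iota y.
  by rewrite -[x]scale1r (special_linear rP) !scale1r.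
have iM := special_mul rP.
(* From eX + Xe = 0 follow eXe = -eX and eXe = eX, hence eX = 0 as 2 is invertible. *)
have null x : a ** x = 0 -> e *m iota x = 0 /\ iota x *m e = 0.
  move/(congr1 iota); rewrite i0 iM ia => /(congr1 ( *:%R 2%:R)).
  rewrite scalerA mulfV // scale1r scaler0 => h.
  have h1 : iota x *m e = - (e *m iota x) by apply/eqP;
    rewrite -addr_eq0 addrC h.
  have h2 : e *m iota x *m e = - (e *m iota x).
    by rewrite -mulmxA h1 mulmxN mulmxA ee.
  have h3 : e *m iota x *m e = e *m iota x.
    by rewrite -[e *m iota x]opprK -h1 mulNmx -mulmxA ee.
  have h4 : e *m iota x = 0.
    have: 2%:R *: (e *m iota x) = 0.
      by rewrite scaler_nat mulr2n -{1}h3 h2 addNr.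
    by move/eqP; rewrite scaler_eq0 (negPf two_neq0) => /eqP.
  by rewrite h1 h4 oppr0.
have half x : a ** x = 2%:R^-1 *: x -> e *m iota x + iota x *m e = iota x.
  move/(congr1 iota); rewrite iZ iM ia => /(congr1 ( *:%R 2%:R)).
  by rewrite !scalerA mulfV // !scale1r.
split.
- by apply: iz; rewrite iM ia ee -mulr2n -scaler_nat scalerA mulVf // scale1r.
- by rewrite /trace_form ia ee tr_e.
- move=> x; apply: iz; rewrite iZ iD iZ !iM !ia /trace_form ia.
  rewrite -eXe -!scalemxAr -!scalemxAl !mulmxDr !mulmxDl !mulmxA ee.
  rewrite -[iota x *m e *m e]mulmxA ee.
  by apply/matrixP=> r s; rewrite !mxE; field.
- move=> x y /null[ex xe] /null[ey ye]; apply: iz; rewrite i0 !iM ia.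
  rewrite -scalemxAr -scalemxAl mulmxDr mulmxDl !mulmxA ex ey !mul0mx.
  by rewrite -!mulmxA xe ye !mulmx0 !(addr0, scaler0).
- move=> x y /null[ex xe] /half hy; apply: iz; rewrite iZ !iM ia.
  congr (_ *: _); rewrite -scalemxAr -scalemxAl -scalerDr; congr (_ *: _).
  rewrite mulmxDr mulmxDl !mulmxA ex mul0mx add0r -[iota y *m _ *m e]mulmxA xe.
  rewrite mulmx0 addr0 -{3 4}hy mulmxDr mulmxDl !mulmxA xe mul0mx add0r.
  by rewrite -[_ *m e *m iota x]mulmxA ex mulmx0 addr0 addrC.
move=> x y /half hx /half hy; apply: iz; rewrite iZ iM ia.
set z := iota (x ** y); have ez : e *m z = z *m e.
  (* Both eXY + XeY and XeY + XYe equal XY, so e commutes with XY. *)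
  have swap X Y : e *m X + X *m e = X -> e *m Y + Y *m e = Y ->
      e *m (X *m Y) = X *m Y *m e.
    move=> hX hY; apply: (addIr (X *m e *m Y)).
    rewrite mulmxA -mulmxDl hX -mulmxA -[X *m e *m Y]mulmxA -mulmxDr addrC.
    by rewrite hY.
  by rewrite /z iM -scalemxAr -scalemxAl mulmxDr mulmxDl !swap.
have ezE : e *m z = \tr (e *m z) *: e by rewrite -eXe -mulmxA -ez mulmxA ee.
by rewrite /trace_form ia -/z -ez -mulr2n -scaler_nat scalerA mulVf // scale1r
  -ezE.
Qed.

End Representation.
End Special.

(** The cases are stated with ring numerals, the form in which matrix indices are written below. *)
Lemma ord2_ind (P : 'I_2 -> Prop) : P 0 -> P 1 -> forall i, P i.
Proof.
move=> P0 P1 [[|[|//]] lt]; [move: P0|move: P1]; by congr P; apply: val_inj.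
Qed.

Lemma ord3_ind (P : 'I_3 -> Prop) : P 0 -> P 1 -> P 2%:R -> forall i, P i.
Proof.
move=> P0 P1 P2 [[|[|[|//]]] lt]; [move: P0|move: P1|move: P2];
  by congr P; apply: val_inj.
Qed.

Section Subalgebra.
Variables (F : fieldType) (A : comNAlgType F) (S : A -> Prop).
Hypothesis sS : subalgebra S.

Lemma subalg0 : S 0. Proof. by case: sS. Qed.

Lemma subalgD x y : S x -> S y -> S (x + y).
Proof. by case: sS => _ sP _ Sx Sy; rewrite -[x]scale1r; apply: sP. Qed.

Lemma subalgZ k x : S x -> S (k *: x).
Proof. by case: sS => S0 sP _ Sx; rewrite -[k *: x]addr0; apply: sP. Qed.

Lemma subalgB x y : S x -> S y -> S (x - y).
Proof. by move=> Sx Sy; rewrite -scaleN1r; apply/subalgD/subalgZ. Qed.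

Lemma subalgM x y : S x -> S y -> S (x ** y).
Proof. by case: sS => _ _; apply. Qed.

Lemma subalg_sum (I : finType) (E : I -> A) : (forall i, S (E i)) -> S (\sum_i
  E i).
Proof. by move=> SE; apply: (big_ind S) => //;
  [apply: subalg0|apply: subalgD]. Qed.

End Subalgebra.

(** * Subalgebras generated by three rank one idempotents *)

Section Outer.
Variables (F : fieldType) (n : nat) (X : 'M[F]_(n, 3)) (Y : 'M[F]_(3, n)).
Hypothesis two_neq0 : 2%:R != 0 :> F.

(** Matrix units twisted by G = YX, see [outerM]. They are idempotent for i = j when G has unit
    diagonal. *)
Definition outer i j : 'M[F]_n := col i X *m row j Y.
Local Notation G := (Y *m X).

Lemma row_mul_col j k : row j Y *m col k X = (G j k)%:M.
Proof.
by apply/matrixP=> r s; rewrite !ord1 !mxE eqxx mulr1n; apply: eq_bigr => t _;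
  rewrite !mxE.
Qed.

Lemma outerM i j k l : outer i j *m outer k l = G j k *: outer i l.
Proof.
by rewrite /outer -mulmxA (mulmxA (row j Y)) row_mul_col mul_scalar_mx
  -scalemxAr.
Qed.

Lemma outer_trace i j : \tr (outer i j) = G j i.
Proof. by rewrite mxtrace_mulC row_mul_col mxtrace_scalar mulr1n. Qed.

Lemma mulmx_outer (N : 'M[F]_3) : X *m N *m Y = \sum_i \sum_j N i j *: outer i
  j.
Proof.
apply/matrixP=> r s; rewrite mxE summxE.
under [RHS]eq_bigr do rewrite summxE.
rewrite exchange_big /=; apply: eq_bigr => j _; rewrite mxE mulr_suml.
apply: eq_bigr => i _; rewrite !mxE big_ord1 !mxE; ring.
Qed.

Lemma outer_nmul i j k l : (outer i j : jmx F n) ** outer k l =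
  2%:R^-1 *: (G j k *: outer i l + G l i *: outer k j) :> 'M_n.
Proof. by rewrite /nmul /= /jmx_nmul !outerM. Qed.

Section Triad.
Variables (T : comNAlgType F) (iota : T -> 'M[F]_n) (a b c : T).
Hypotheses (rP : special_rep iota) (G1 : forall i, G i i = 1).
Hypotheses (ia : iota a = outer 0 0) (ib : iota b = outer 1 1).
Hypothesis ic : iota c = outer 2%:R 2%:R.
Hypothesis gen : forall S : jmx F n -> Prop, subalgebra S ->
  (forall i, S (outer i i)) -> forall t, S (iota t).

(** Traces of products of the idempotents are products of entries of G along closed paths; the last
    parameter averages the two orientations of the triangle. *)
Lemma special_triad : triad (trace_form iota) a b c
  (G 0 1 * G 1 0) (G 1 2%:R * G 2%:R 1) (G 2%:R 0 * G 0 2%:R)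
  (2%:R^-1 * (G 0 1 * G 1 2%:R * G 2%:R 0 + G 0 2%:R * G 2%:R 1 * G 1 0)).
Proof.
have ax i t : iota t = outer i i -> axial (trace_form iota) t.
  by move=> it; apply: (special_axial two_neq0 rP it); rewrite row_mul_col G1.
split.
- exact: trace_assoc_form.
- exact: ax ia.
- exact: ax ib.
- exact: ax ic.
- move=> S sS Sabc t.
  (* The image of S in the matrices is a subalgebra containing the three idempotents, so [gen]
     applies to it, and injectivity of [iota] leads back to S. *)
  pose S' (M : jmx F n) := exists2 u, iota u = M & S u.
  have sS' : subalgebra S'.
    split=> [|k M N [u <- Su] [v <- Sv]|M N [u <- Su] [v <- Sv]].
    - exists 0; last exact: subalg0.
      by rewrite -[0 : T](addNr 0) -scaleN1r (special_linear rP) scaleN1r addNr.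
    - exists (k *: u + v); first exact: (special_linear rP).
      by case: sS => _ + _; apply.
    - exists (u ** v); first exact: (special_mul rP).
      exact: subalgM.
  have [|u /(special_inj rP) <- //] := gen sS' _ t.
  apply: ord3_ind; [exists a|exists b|exists c] => //; apply: Sabc;
    by [apply: Or31|apply: Or32|apply: Or33].
- by rewrite /trace_form ia ib outerM mxtraceZ outer_trace.
- by rewrite /trace_form ib ic outerM mxtraceZ outer_trace.
- by rewrite /trace_form ic ia outerM mxtraceZ outer_trace.
rewrite /trace_form (special_mul rP) ia ib ic !outerM -scalemxAr mulmxDr.
rewrite -!scalemxAr !outerM !(mxtraceZ, mxtraceD) !outer_trace; ring.
Qed.

End Triad.

Section Generation.
Variable S : jmx F n -> Prop.
Hypotheses (sS : subalgebra S) (S_diag : forall i, S (outer i i)).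
Hypothesis G1 : forall i, G i i = 1.

Let sym i j := G i j *: outer i j + G j i *: outer j i.

Let S_sym i j : S (sym i j).
Proof.
have := subalgZ sS 2%:R (subalgM sS (S_diag i) (S_diag j)).
by rewrite outer_nmul scalerA mulfV // scale1r.
Qed.

(** With e_i the idempotent [outer i i], S contains e_i e_k + e_k e_i and the Jordan triple product
    e_i e_j e_k + e_k e_j e_i. Both are combinations of [outer i k] and [outer k i], and by
    assumption their determinant is nonzero. *)
Lemma outer_generated i j k :
  G i j * G j k * G k i != G i k * G k j * G j i ->
  S (outer i k) /\ S (outer k i).
Proof.
move=> pq.
pose tri i j k := 2%:R *: ((outer i i : jmx F n) ** sym j k).
have S_tri i' j' k' : S (tri i' j' k').
  by apply: subalgZ => //; apply: subalgM.
have triE i' j' k' : tri i' j' k' =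
    G j' k' *: (G i' j' *: outer i' k' + G k' i' *: outer j' i') +
    G k' j' *: (G i' k' *: outer i' j' + G j' i' *: outer k' i').
  rewrite /tri /sym /nmul /= /jmx_nmul scalerA mulfV // scale1r.
  rewrite !mulmxDl !mulmxDr -!scalemxAl -!scalemxAr !outerM.
  move: (outer i' k') (outer j' i') (outer i' j') (outer k' i') => E1 E2 E3 E4.
  by move: (Y *m X) => H; apply/matrixP=> r s; rewrite !mxE; ring.
(* The Jordan triple product, equal to half of [tri i j k + tri k i j - tri j k i]. *)
pose U := (G i j * G j k) *: outer i k + (G k j * G j i) *: outer k i.
have S_U : S U.
  have := subalgZ sS 2%:R^-1 (subalgB sS (subalgD sS (S_tri i j k) (S_tri k i
    j)) (S_tri j k i)).
  congr S; rewrite !triE /U; move: (Y *m X) (outer) => H E.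
  apply/matrixP=> r s; rewrite !mxE; field.
  by rewrite two_neq0.
(* The determinant of [U] and [sym i k]; Cramer's rule then isolates the two outer products. *)
have d0 : G i j * G j k * G k i - G i k * G k j * G j i != 0 by rewrite
  subr_eq0.
split.
- have := subalgZ sS (G i j * G j k * G k i - G i k * G k j * G j i)^-1
    (subalgB sS (subalgZ sS (G k i) S_U) (subalgZ sS (G k j * G j i) (S_sym i
      k))).
  congr S; rewrite /U /sym; move: (outer i k) (outer k i) => E E'.
  move: d0; move: (Y *m X) => H d0; by apply/matrixP=> r s; rewrite !mxE; field.
have := subalgZ sS (G i j * G j k * G k i - G i k * G k j * G j i)^-1
    (subalgB sS (subalgZ sS (G i j * G j k) (S_sym i k)) (subalgZ sS (G i k)
      S_U)).
congr S; rewrite /U /sym; move: (outer i k) (outer k i) => E E'.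
move: d0; move: (Y *m X) => H d0; by apply/matrixP=> r s; rewrite !mxE; field.
Qed.

Lemma outer_generates_full (K : 'M_(3, n)) (L : 'M_(n, 3)) :
  X *m K = 1%:M -> L *m Y = 1%:M ->
  G 0 1 * G 1 2%:R * G 2%:R 0 != G 0 2%:R * G 2%:R 1 * G 1 0 ->
  forall M, S M.
Proof.
move=> XK LY pq M.
have [S02 S20] := outer_generated pq.
have [|S10 S01] := @outer_generated 1 2%:R 0.
  apply: contraNneq pq => e; apply/eqP.
  by transitivity (G 1 2%:R * G 2%:R 0 * G 0 1); [ring | rewrite e; ring].
have [|S21 S12] := @outer_generated 2%:R 0 1.
  apply: contraNneq pq => e; apply/eqP.
  by transitivity (G 2%:R 0 * G 0 1 * G 1 2%:R); [ring | rewrite e; ring].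
have S_outer i j : S (outer i j).
  by elim/ord3_ind: i; elim/ord3_ind: j.
(* The one-sided inverses write M as XNY, a combination of outer products. *)
have -> : M = X *m (K *m M *m L) *m Y.
  by rewrite !mulmxA XK mul1mx -mulmxA LY mulmx1.
rewrite mulmx_outer; apply: (subalg_sum sS) => i; apply: (subalg_sum sS) => j.
exact: (subalgZ sS _ (S_outer i j)).
Qed.

End Generation.

End Outer.

(** * Generation of the symmetric matrices *)

Section Symmetric.
Variables (F : fieldType) (n : nat) (X : 'M[F]_(n, 3)).
Hypothesis two_neq0 : 2%:R != 0 :> F.
Local Notation G := (X^T *m X).
Local Notation outer := (outer X X^T).

Lemma outer_generates_sym (S : jmx F n -> Prop) (K : 'M_(3, n)) :
  subalgebra S -> (forall i, S (outer i i)) -> (forall i, G i i = 1) ->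
  X *m K = 1%:M -> G 0 1 != 0 -> G 1 2%:R != 0 ->
  forall M : 'M_n, M^T = M -> S M.
Proof.
move=> sS S_diag G1 XK G01 G12 M symM.
have GC i j : G j i = G i j.
  have /matrixP/(_ i j) : G^T = G by rewrite trmx_mul trmxK.
  by rewrite [LHS]mxE.
pose E i j : jmx F n := outer i j + outer j i.
have EC i j : E j i = E i j by rewrite /E addrC.
have S_near i j : G i j != 0 -> S (E i j).
  move=> Gij.
  have := subalgZ sS (2%:R / G i j) (subalgM sS (S_diag i) (S_diag j)).
  rewrite outer_nmul [G j i]GC -scalerDr !scalerA; congr S.
  have -> : 2%:R / G i j / 2%:R * G i j = 1 by field; rewrite two_neq0 Gij.
  by rewrite scale1r.
have S01 := S_near _ _ G01; have S12 := S_near _ _ G12.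
(* The entry G 0 2 may vanish, so this sum is taken from the product of [E 0 1] and [E 1 2], where
   its coefficient comes from G 1 1 = 1 and the remaining terms are known to lie in S. *)
have S02 : S (E 0 2%:R).
  have := subalgB sS (subalgZ sS 2%:R (subalgM sS S01 S12)) (subalgD sS
    (subalgD sS (subalgZ sS (G 1 2%:R) S01) (subalgZ sS (G 0 1) S12))
    (subalgZ sS (2%:R * G 0 2%:R) (S_diag 1))).
  congr S; rewrite /nmul /= /jmx_nmul scalerA mulfV // scale1r /E.
  rewrite !mulmxDl !mulmxDr !outerM (GC 0 1) (GC 1 2%:R) (GC 0 2%:R) G1.
  move: (outer) (G) => D H.
  by apply/matrixP=> r s; rewrite !mxE; ring.
have S_E i j : S (E i j).
  elim/ord3_ind: i; elim/ord3_ind: j => //; rewrite 1?EC //;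
    exact: (subalgD sS (S_diag _) (S_diag _)).
have MC i j : (K *m M *m K^T) j i = (K *m M *m K^T) i j.
  have /matrixP/(_ i j) : (K *m M *m K^T)^T = K *m M *m K^T.
    by rewrite !trmx_mul trmxK symM mulmxA.
  by rewrite [LHS]mxE.
have eM : M = X *m (K *m M *m K^T) *m X^T.
  by rewrite !mulmxA XK mul1mx -mulmxA -trmx_mul XK trmx1 mulmx1.
have -> : M = \sum_i \sum_j (2%:R^-1 * (K *m M *m K^T) i j) *: E i j.
  have eM2 : M = \sum_i \sum_j (K *m M *m K^T) i j *: outer j i.
    rewrite exchange_big {1}eM mulmx_outer; apply: eq_bigr => i _.
    by apply: eq_bigr => j _; rewrite MC.
  (* Averaging the expansion of M with its transposed form turns outer products into the sums
     [E i j]. *)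
  transitivity (2%:R^-1 *: (M + M)).
    by rewrite -mulr2n -scaler_nat scalerA mulVf // scale1r.
  rewrite {1}eM mulmx_outer {2}eM2 -big_split scaler_sumr.
  apply: eq_bigr => i _; rewrite -big_split scaler_sumr.
  by apply: eq_bigr => j _; rewrite /= -scalerDr scalerA.
apply: (subalg_sum sS) => i; apply: (subalg_sum sS) => j.
exact: (subalgZ sS _ (S_E i j)).
Qed.

End Symmetric.

Section Representations.
Variables (F : fieldType) (n : nat).
Hypothesis two_neq0 : 2%:R != 0 :> F.

Lemma jmx_special : special_rep (fun M : jmx F n => M).
Proof.
split=> // M h; apply/matrixP=> i j; rewrite mxE.
have := h (delta_mx j i); rewrite /trace_form.
rewrite /mxtrace (bigD1 i) //= big1 => [|k ki]; last first.
  rewrite !mxE big1 // => l _; rewrite !mxE.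
  by rewrite (negPf ki) andbF mulr0.
rewrite addr0 !mxE (bigD1 j) //= big1 => [|l lj]; last first.
  by rewrite !mxE (negPf lj) mulr0.
by rewrite addr0 !mxE !eqxx mulr1.
Qed.

(** For symmetric S, tr(SN) = tr(SN^T), so S is orthogonal to N once it is orthogonal to the
    symmetric matrix N + N^T. *)
Lemma sym_jmx_special : special_rep (@sym_jmx_val F n).
Proof.
split=> // S h; apply/val_inj; change (sym_jmx_val S = 0).
have symS : (sym_jmx_val S)^T = sym_jmx_val S by apply/eqP/(valP S).
apply: (special_nondeg jmx_special) => N; rewrite /trace_form.
have symN : ((N : 'M_n) + N^T : jmx F n) \in @trmx_fixed F n.
  by apply/eqP; rewrite linearD /= trmxK addrC.
have := h (SymJmx symN); rewrite /trace_form /= mulmxDr mxtraceD.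
have -> : \tr (sym_jmx_val S *m N^T) = \tr (sym_jmx_val S *m N).
  by rewrite -mxtrace_tr trmx_mul trmxK symS mxtrace_mulC.
move/eqP; rewrite -mulr2n -mulr_natl mulf_eq0 (negPf two_neq0) => /eqP //.
Qed.

End Representations.

(** * Classification *)

Section Cases.
Variables (F : fieldType) (A : comNAlgType F) (f : A -> A -> F).
Hypothesis Fqc : quadratically_closed F.
Hypothesis two_neq0 : 2%:R != 0 :> F.

Definition mx_of_rows m n (g : seq (seq F)) : 'M[F]_(m, n) :=
  \matrix_(i, j) (nth [::] g i)`_j.

Lemma triad_iso_jmx a b c al be ga ps : triad f a b c al be ga ps ->
  ps ^+ 2 != al * be * ga -> alg_iso A (jmx F 2) \/ alg_iso A (jmx F 3).
Proof.
(* The roots of t^2 - 2 ps t + al be ga are p and al be ga / p, distinct by assumption. The sign of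
   the square root is chosen to make p nonzero. *)
move=> tP psE.
have [p [p_neq0 psp pq]] : exists p, [/\ p != 0,
    ps = 2%:R^-1 * (p + al * be * ga / p) & p != al * be * ga / p].
  have [d dE] := Fqc (ps ^+ 2 - al * be * ga).
  have d_neq0 : d != 0 by rewrite -sqrf_eq0 dE subr_eq0.
  have [e [eE pe]] : exists e, e ^+ 2 = d ^+ 2 /\ ps + e != 0.
    case: (eqVneq (ps + d) 0) => [e0|]; last by exists d.
    exists (- d); split; first by rewrite sqrrN.
    have -> : ps = - d by apply/eqP; rewrite -addr_eq0 e0.
    by rewrite -opprD oppr_eq0 -mulr2n -mulr_natl mulf_neq0.
  have e_neq0 : e != 0 by rewrite -sqrf_eq0 eE sqrf_eq0.
  have q : al * be * ga / (ps + e) = ps - e.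
    apply: (mulIf pe); rewrite mulfVK //.
    have -> : al * be * ga = ps ^+ 2 - e ^+ 2 by rewrite eE dE; ring.
    by ring.
  exists (ps + e); split=> //; rewrite q; first by field.
  rewrite -subr_eq0; have -> : ps + e - (ps - e) = 2%:R * e by ring.
  by rewrite mulf_neq0.
(* Opposite entries multiply to al, be, ga, and the two cyclic products are p and al be ga / p. *)
pose G : 'M[F]_3 := mx_of_rows 3 3 [:: [:: 1; 1; ga / p]; [:: al; 1; 1];
  [:: p; be; 1]].
have GE i j : G i j = (nth [::] [:: [:: 1; 1; ga / p]; [:: al; 1; 1]; [:: p;
  be; 1]] i)`_j.
  by rewrite mxE.
have G1 i : G i i = 1 by elim/ord3_ind: i; rewrite GE.
have [r [X [Y [K [L [GXY XK LY]]]]]] : exists r (X : 'M_(r, 3)) (Y : 'M_(3, r))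
  K L,
    [/\ Y *m X = G, X *m K = 1%:M & L *m Y = 1%:M].
  have [K XK] := row_freeP (row_base_free G).
  have [L LY] := row_fullP (col_base_full G).
  by exists (\rank G), (row_base G), (col_base G), K, L; rewrite mulmx_base.
have asym : G 0 1 * G 1 2%:R * G 2%:R 0 != G 0 2%:R * G 2%:R 1 * G 1 0.
  rewrite !GE /= !mul1r; apply: contraNneq pq => e; apply/eqP.
  by rewrite {1}e; field.
have iso : alg_iso A (jmx F r).
  have gen (S : jmx F r -> Prop) : subalgebra S ->
      (forall i, S (outer X Y i i)) -> forall t, S t.
    move=> sS S_diag t.
    by apply: (outer_generates_full two_neq0 sS S_diag XK LY); rewrite GXY.
  have := @special_triad F r X Y two_neq0 (jmx F r) _ (outer X Y 0 0)
    (outer X Y 1 1) (outer X Y 2%:R 2%:R) (jmx_special F r).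
  rewrite GXY => /(_ G1 erefl erefl erefl gen).
  rewrite !GE /= !mul1r.
  have -> : p * (ga / p) = ga by field.
  have -> : 2%:R^-1 * (p + ga / p * be * al) = ps.
    by rewrite psp; field; rewrite two_neq0 p_neq0.
  exact: (triad_iso two_neq0 tP).
have r3 : (r <= 3)%N.
  by rewrite -(mxrank1 F r) -XK (leq_trans (mxrankM_maxl _ _)) // rank_leq_col.
(* Rank 0 contradicts the unit diagonal; in rank 1 the two cyclic products would coincide. *)
case: r => [|[|[|[|//]]]] in X Y K L GXY XK LY iso r3 *;
  [exfalso|exfalso|by left|by right].
  by have := oner_neq0 F; rewrite -(G1 0) -GXY mxE big_ord0 eqxx.
case/eqP: asym; rewrite -GXY !mxE !big_ord1; ring.
Qed.

Lemma triad_iso_sym n (X : 'M[F]_(n, 3)) (K : 'M_(3, n)) a b c al be ga ps :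
  triad f a b c al be ga ps -> X *m K = 1%:M ->
  let G := X^T *m X in
  (forall i, G i i = 1) -> G 0 1 != 0 -> G 1 2%:R != 0 ->
  [/\ al = G 0 1 ^+ 2, be = G 1 2%:R ^+ 2, ga = G 0 2%:R ^+ 2
    & ps = G 0 1 * G 1 2%:R * G 0 2%:R] ->
  alg_iso A (sym_jmx F n).
Proof.
move=> tP XK G G1 G01 G12 [alE beE gaE psE].
have GC i j : G j i = G i j.
  have /matrixP/(_ i j) : G^T = G by rewrite trmx_mul trmxK.
  by rewrite [LHS]mxE.
have symO i : (outer X X^T i i : jmx F n) \in @trmx_fixed F n.
  by apply/eqP; rewrite /outer trmx_mul tr_row trmxK tr_col.
have gen (S : jmx F n -> Prop) : subalgebra S ->
    (forall i, S (outer X X^T i i)) -> forall t : sym_jmx F n, S (sym_jmx_val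
      t).
  move=> sS S_diag [M symM] /=.
  by apply: (outer_generates_sym two_neq0 sS S_diag G1 XK G01 G12); apply/eqP.
have := @special_triad F n X X^T two_neq0 (sym_jmx F n) _ (SymJmx (symO 0))
  (SymJmx (symO 1)) (SymJmx (symO 2%:R)) (sym_jmx_special n two_neq0) G1 erefl
    erefl erefl gen.
rewrite -/G (GC 0 1) (GC 1 2%:R) (GC 0 2%:R) .
have -> : 2%:R^-1 * (G 0 1 * G 1 2%:R * G 0 2%:R + G 0 2%:R * G 1 2%:R * G 0 1)
  = ps.
  by rewrite psE; field; rewrite two_neq0.
rewrite -!expr2 -alE -beE -gaE; exact: (triad_iso two_neq0 tP).
Qed.

End Cases.

(** * Gram vectors for the symmetric models *)

Section Connected.
Variables (F : fieldType) (A : comNAlgType F) (f : A -> A -> F).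
Hypothesis Fqc : quadratically_closed F.
Hypothesis two_neq0 : 2%:R != 0 :> F.

Let mx_mulE m n p (g h : seq (seq F)) i j :
  (mx_of_rows m n g *m mx_of_rows n p h) i j =
  \sum_(k < n) (nth [::] g i)`_k * (nth [::] h k)`_j.
Proof. by rewrite mxE; apply: eq_bigr => k _; rewrite !mxE. Qed.

Let gram_mxE n (g : seq (seq F)) i j :
  ((mx_of_rows n 3 g)^T *m mx_of_rows n 3 g) i j =
  \sum_(k < n) (nth [::] g k)`_i * (nth [::] g k)`_j.
Proof. by rewrite mxE; apply: eq_bigr => k _; rewrite !mxE. Qed.

(** Gram-Schmidt: the columns (1, 0, 0), (g, s, 0), (k, u, t) have norm 1 and inner products g, h,
    k. As al is not 1, s is invertible; whether t vanishes decides between sizes 2 and 3. *)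
Lemma triad_iso_sym_pivot a b c al be ga ps : triad f a b c al be ga ps ->
  ps ^+ 2 = al * be * ga -> al != 0 -> be != 0 -> al != 1 ->
  alg_iso A (sym_jmx F 2) \/ alg_iso A (sym_jmx F 3).
Proof.
move=> tP psE al0 be0 al1.
have [g gE] := Fqc al; have [h hE] := Fqc be; have [s sE] := Fqc (1 - al).
have g0 : g != 0 by rewrite -sqrf_eq0 gE.
have h0 : h != 0 by rewrite -sqrf_eq0 hE.
have s0 : s != 0 by rewrite -sqrf_eq0 sE subr_eq0 eq_sym.
(* The signs of g and h are free and that of k is then forced by ps = g h k; u gives the last two
   columns the inner product h. *)
pose k := ps / (g * h); pose u := (h - g * k) / s.
have kE : k ^+ 2 = ga by rewrite expr_div_n psE exprMn gE hE; field;
  rewrite al0 be0.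
have psk : ps = g * h * k by rewrite /k; field; rewrite g0 h0.
have gs : g ^+ 2 + s ^+ 2 = 1 by rewrite gE sE; ring.
have su : g * k + s * u = h by rewrite /u; field.
have [t tE] := Fqc (1 - k ^+ 2 - u ^+ 2).
have kut : k ^+ 2 + u ^+ 2 + t ^+ 2 = 1 by rewrite tE; ring.
case: (eqVneq t 0) => [t0|t0]; [left|right].
  pose r := [:: [:: 1; g; k]; [:: 0; s; u]].
  pose r' := [:: [:: 1; - g / s]; [:: 0; s^-1]; [:: 0; 0]].
  have XK : mx_of_rows 2 3 r *m mx_of_rows 3 2 r' = 1%:M.
    by apply/matrixP => -[[|[|//]] ?] -[[|[|//]] ?];
      rewrite mx_mulE !big_ord_recl big_ord0 mxE /=; field.
  have GE i j : ((mx_of_rows 2 3 r)^T *m mx_of_rows 2 3 r) i j =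
      [:: 1; g; k]`_i * [:: 1; g; k]`_j + [:: 0; s; u]`_i * [:: 0; s; u]`_j.
    by rewrite gram_mxE !big_ord_recl big_ord0 /= addr0.
  apply: (triad_iso_sym two_neq0 tP XK).
  - elim/ord3_ind; rewrite GE /=; first by ring.
      by rewrite -!expr2.
    by rewrite -kut t0; ring.
  - by rewrite GE /= mul0r addr0 mul1r.
  - by rewrite GE /= su.
  by rewrite !GE /= su !mul0r !mul1r !addr0 gE hE kE.
pose r := [:: [:: 1; g; k]; [:: 0; s; u]; [:: 0; 0; t]].
pose r' := [:: [:: 1; - g / s; (g * u - k * s) / (s * t)];
               [:: 0; s^-1; - u / (s * t)]; [:: 0; 0; t^-1]].
have XK : mx_of_rows 3 3 r *m mx_of_rows 3 3 r' = 1%:M.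
  by apply/matrixP => -[[|[|[|//]]] ?] -[[|[|[|//]]] ?];
    rewrite mx_mulE !big_ord_recl big_ord0 mxE /=; field; rewrite ?s0 ?t0.
have GE i j : ((mx_of_rows 3 3 r)^T *m mx_of_rows 3 3 r) i j =
    [:: 1; g; k]`_i * [:: 1; g; k]`_j + [:: 0; s; u]`_i * [:: 0; s; u]`_j
    + [:: 0; 0; t]`_i * [:: 0; 0; t]`_j.
  by rewrite gram_mxE !big_ord_recl big_ord0 /= addr0 addrA.
apply: (triad_iso_sym two_neq0 tP XK).
- elim/ord3_ind; rewrite GE /=; first by ring.
    by rewrite mul0r addr0 -!expr2.
  by rewrite -!expr2.
- by rewrite GE /= !mul0r !addr0 mul1r.
- by rewrite GE /= su mul0r addr0.
by rewrite !GE /= su !mul0r !mul1r !addr0 gE hE kE.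
Qed.

(** The middle column is (1, 0, 0), and the outer ones differ from it by the isotropic vectors (0,
    1, i) and k(0, 1, -i) with i^2 = -1. The outer ones have inner product 1 + 2k = ps, and k is
    nonzero, so the matrix is invertible. *)
Lemma triad_iso_sym_isotropic a b c ga ps : triad f a b c 1 1 ga ps ->
  ps ^+ 2 = ga -> ps != 1 -> alg_iso A (sym_jmx F 3).
Proof.
move=> tP psE ps1.
have [i iE] := Fqc (- 1).
have i0 : i != 0 by rewrite -sqrf_eq0 iE oppr_eq0 oner_eq0.
pose k := (ps - 1) / 2%:R.
have k0 : k != 0 by rewrite mulf_neq0 ?invr_eq0 // subr_eq0.
have psk : ps = 1 + 2%:R * k by rewrite /k; field; rewrite two_neq0.
clearbody k; have i2 : i * i = - 1 by rewrite -expr2.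
pose r := [:: [:: 1; 1; 1]; [:: 1; 0; k]; [:: i; 0; - (i * k)]].
pose r' := [:: [:: 0; 2%:R^-1; (2%:R * i)^-1];
               [:: 1; - (1 + k^-1) / 2%:R; (k^-1 - 1) / (2%:R * i)];
               [:: 0; (2%:R * k)^-1; - (2%:R * k * i)^-1]].
have XK : mx_of_rows 3 3 r *m mx_of_rows 3 3 r' = 1%:M.
  by apply/matrixP => -[[|[|[|//]]] ?] -[[|[|[|//]]] ?];
    rewrite mx_mulE !big_ord_recl big_ord0 mxE /=; field;
      rewrite ?two_neq0 ?i0 ?k0.
have GE x y : ((mx_of_rows 3 3 r)^T *m mx_of_rows 3 3 r) x y =
    [:: 1; 1; 1]`_x * [:: 1; 1; 1]`_y + [:: 1; 0; k]`_x * [:: 1; 0; k]`_y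
    + [:: i; 0; - (i * k)]`_x * [:: i; 0; - (i * k)]`_y.
  by rewrite gram_mxE !big_ord_recl big_ord0 /= addr0 addrA.
have G02 : 1 * 1 + 1 * k + i * - (i * k) = ps.
  by rewrite psk mulrN mulrA i2; ring.
apply: (triad_iso_sym two_neq0 tP XK).
- elim/ord3_ind; rewrite GE /=; first by rewrite i2; ring.
    by ring.
  by rewrite mulrNN mulrACA i2; ring.
- by rewrite GE /= !mulr0 !addr0 mul1r oner_eq0.
- by rewrite GE /= !mul0r !addr0 mul1r oner_eq0.
by rewrite !GE /= G02 !mulr0 !mul0r !addr0 !mul1r expr1n psE.
Qed.

End Connected.

(** * Models that split off copies of F *)

Section Isolated.
Variables (F : fieldType).
Hypothesis Fqc : quadratically_closed F.
Hypothesis two_neq0 : 2%:R != 0 :> F.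

Section Power.
Variable n : nat.
Implicit Types u v : power_alg F n.

Definition power_form u v : F := \sum_i (u i : F) * v i.
Definition power_delta (i : 'I_n) : power_alg F n := [ffun j => (j == i)%:R].

Lemma power_form_delta i u : power_form (power_delta i) u = u i.
Proof.
rewrite /power_form (bigD1 i) //= big1 => [|j ji].
  by rewrite ffunE eqxx mul1r addr0.
by rewrite ffunE (negPf ji) mul0r.
Qed.

Lemma power_assoc_form : assoc_form power_form.
Proof.
split.
- move=> k x y z; rewrite /power_form mulr_sumr -big_split /=.
  by apply: eq_bigr => i _; rewrite !ffunE mulrDl mulrA.
- by move=> x y; apply: eq_bigr => i _; rewrite mulrC.
- by move=> x y z; apply: eq_bigr => i _; rewrite !ffunE mulrA.
move=> x x0; apply/ffunP => i; rewrite ffunE -(x0 (power_delta i)).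
rewrite -(power_form_delta i x); apply: eq_bigr => j _.
by rewrite mulrC.
Qed.

Lemma power_mulE u v i : (u ** v) i = (u i : F) * v i.
Proof. by rewrite ffunE. Qed.

Lemma power_axial i : axial power_form (power_delta i).
Proof.
apply: scalar_axial => //; first exact: power_assoc_form.
  by rewrite power_form_delta ffunE eqxx.
move=> u; rewrite power_form_delta; apply/ffunP => j; rewrite power_mulE !ffunE.
rewrite mulrC; case: eqP => [->//|_].
by rewrite !mulr0 scaler0.
Qed.

(** The indices may repeat, so three axes serve for one, two and three copies of F. *)
Lemma power_triad i0 i1 i2 : (forall i, [\/ i = i0, i = i1 | i = i2]) ->
  triad power_form (power_delta i0) (power_delta i1) (power_delta i2)
    (i0 == i1)%:R (i1 == i2)%:R (i2 == i0)%:R ((i0 == i1) && (i0 == i2))%:R.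
Proof.
move=> cover; split; do ?exact: power_axial; first exact: power_assoc_form;
  rewrite ?power_form_delta ?power_mulE ?ffunE //.
move=> S sS Sdelta u.
have -> : u = \sum_i (u i : F) *: power_delta i.
  apply/ffunP => j; rewrite sum_ffunE (bigD1 j) //= big1 => [|i ij].
    by rewrite !ffunE eqxx addr0; apply: esym; apply: mulr1.
  by rewrite !ffunE eq_sym (negPf ij) scaler0.
  apply: (subalg_sum sS) => i; apply: (subalgZ sS); apply: Sdelta.
by case: (cover i) => ->; [apply: Or31|apply: Or32|apply: Or33].
by rewrite -natrM mulnb.
Qed.

End Power.

Definition regular_form (x y : F^o) : F := (x : F) * y.

Lemma regular_assoc_form : assoc_form regular_form.
Proof.
split; rewrite /regular_form.
- by move=> k x y z; rewrite mulrDl mulrA.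
- by move=> x y; rewrite mulrC.
- by move=> x y z; rewrite mulrA.
by move=> x /(_ 1); rewrite mulr1.
Qed.

Lemma triad_iso_product (A : comNAlgType F) (f : A -> A -> F) a b c al :
  triad f a b c al 0 0 0 -> al != 0 -> al != 1 ->
  alg_iso A (F^o * sym_jmx F 2)%type.
Proof.
move=> tP al0 al1.
have [g gE] := Fqc al; have [s sE] := Fqc (1 - al).
have g0 : g != 0 by rewrite -sqrf_eq0 gE.
have s0 : s != 0 by rewrite -sqrf_eq0 sE subr_eq0 eq_sym.
have gs : g * g + s * s = 1 by rewrite -!expr2 gE sE; ring.
(* The symmetric factor has only two idempotents. Repeating the second column supplies the third
   index that [outer_generates_sym] expects, with G 1 2 = 1. *)
pose r := [:: [:: 1; g; g]; [:: 0; s; s]].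
pose r' := [:: [:: 1; - g / s]; [:: 0; s^-1]; [:: 0; 0]].
pose X : 'M[F]_(2, 3) := mx_of_rows 2 3 r.
have XK : X *m mx_of_rows 3 2 r' = 1%:M.
  apply/matrixP => -[[|[|//]] ?] -[[|[|//]] ?];
    rewrite !mxE !big_ord_recl big_ord0 !mxE /=; field => //.
have GE i j : (X^T *m X) i j =
    [:: 1; g; g]`_i * [:: 1; g; g]`_j + [:: 0; s; s]`_i * [:: 0; s; s]`_j.
  by rewrite mxE !big_ord_recl big_ord0 !mxE /= addr0.
have G1 i : (X^T *m X) i i = 1 by elim/ord3_ind: i; rewrite GE //=; ring.
have symO i : (outer X X^T i i : jmx F 2) \in @trmx_fixed F 2.
  by apply/eqP; rewrite /outer trmx_mul tr_row trmxK tr_col.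
pose e i : sym_jmx F 2 := SymJmx (symO i).
have rP := sym_jmx_special 2 two_neq0.
pose h := pair_form regular_form (trace_form (@sym_jmx_val F 2)).
have hP : assoc_form h := pair_assoc_form regular_assoc_form (trace_assoc_form
  rP).
have eP i : axial h (0, e i).
  apply: pair_axialr; first exact: regular_assoc_form.
  have ie : sym_jmx_val (e i) = col i X *m row i X^T by [].
  by apply: (special_axial two_neq0 rP ie); rewrite row_mul_col G1.
apply: (triad_iso two_neq0 tP (T := (F^o * sym_jmx F 2)%type) (g := h)
  (a' := (0, e 0)) (b' := (0, e 1)) (c' := (1, 0))).
split=> //.
- apply: scalar_axial => //.
    by rewrite /h /pair_form /= /regular_form mulr1 (aform0l (trace_assoc_form
      rP)) addr0.
  move=> [x M]; rewrite /h /pair_form /= (aform0l (trace_assoc_form rP)) addr0.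
  rewrite {1}/nmul /= /pair_nmul /= nmul0l; congr pair; last by rewrite scaler0.
  by rewrite /regular_form mul1r; apply: (mulrC (1 : F) x).
- move=> S sS Sabc.
  (* The third axis is the unit of the summand F, so S contains this summand; [S2] is the part of S
     in the other factor. *)
  have S1 x : S (x, 0).
    have := subalgZ sS x (Sabc (1, 0) (Or33 _ _ erefl)).
    by congr S; congr pair => /=; [apply: mulr1|rewrite scaler0].
  pose S2 (M : jmx F 2) := exists2 t : sym_jmx F 2, sym_jmx_val t = M & S (0,
    t).
  have sS2 : subalgebra S2.
    split=> [|k M N [t <- St] [t' <- St']|M N [t <- St] [t' <- St']].
    - by exists 0 => //; apply: (subalg0 sS).
    - exists (k *: t + t') => //.
      have := subalgD sS (subalgZ sS k St) St'.
      by congr S; congr pair; rewrite /= scaler0 addr0.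
    - exists (t ** t') => //; have := subalgM sS St St'.
      by congr S; congr pair; apply: (mulr0 (0 : F)).
  have S2e i : S2 (outer X X^T i i).
    elim/ord3_ind: i; [exists (e 0)|exists (e 1)|exists (e 1)] => //.
    - exact: Sabc (Or31 _ _ erefl).
    - exact: Sabc (Or32 _ _ erefl).
    - have eX : col 1 X = col 2%:R X.
        by apply/matrixP => -[[|[|//]] ?] j; rewrite !mxE.
      by rewrite /= /outer -!tr_col eX.
    - exact: Sabc (Or32 _ _ erefl).
  move=> [x M].
  have : S2 (sym_jmx_val M).
    apply: (outer_generates_sym two_neq0 sS2 S2e G1 XK).
    - by rewrite GE /= mul0r addr0 mul1r.
    - by rewrite GE /= gs oner_eq0.
    by apply/eqP; exact: (valP M).
  case=> t /val_inj -> SM; have := subalgD sS (S1 x) SM.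
  by congr S; congr pair; rewrite /= ?addr0 ?add0r.
- rewrite /h /pair_form /= (aform0l regular_assoc_form) add0r.
  rewrite /trace_form outerM mxtraceZ outer_trace !GE /= mul0r addr0 mul1r
    mulr0 addr0 mulr1.
  by rewrite -expr2.
- by rewrite /h /pair_form /= (aform0l regular_assoc_form) (aform0r
  (trace_assoc_form rP)) addr0.
- by rewrite /h /pair_form /= (aform0r regular_assoc_form) (aform0l
  (trace_assoc_form rP)) addr0.
rewrite /h /pair_form /= nmul0r (aform0l regular_assoc_form).
by rewrite (aform0r (trace_assoc_form rP)) addr0.
Qed.

End Isolated.

(** * The symmetric matrices of size 2 as a spin factor *)

Section SpinFactor.
Variables (F : fieldType) (V : vectType F) (phi : {symmetric V}).
Hypothesis Fqc : quadratically_closed F.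
Hypothesis two_neq0 : 2%:R != 0 :> F.
Hypothesis phiP : jform_data 2 phi.

Let phiC u v : phi u v = phi v u.
Proof. by rewrite hermitian_subproof expr0 mul1r. Qed.

Lemma orthonormal_pair : exists e1 e2 : V,
  [/\ phi e1 e1 = 1, phi e2 e2 = 1, phi e1 e2 = 0
    & forall v, v = phi e1 v *: e1 + phi e2 v *: e2].
Proof.
have [dimV /eqP radV] := phiP.
have nondeg u : u != 0 -> exists v, phi u v != 0.
  move=> u0; have : u \notin orthov phi fullv by rewrite radV memv0.
  by case/mem_orthovPn => v _ uv; exists v.
have normalize w : phi w w != 0 -> exists k, phi (k *: w) (k *: w) = 1.
  move=> w0; have [k kE] := Fqc (phi w w); exists k^-1.
  have k0 : k != 0 by rewrite -sqrf_eq0 kE.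
  by rewrite linearZl linearZr /= -kE; field.
have [e1 e11] : exists e1, phi e1 e1 = 1.
  suff [w /normalize[k kw]] : exists w, phi w w != 0 by exists (k *: w).
  have [v uv] : exists v, phi (vpick {:V}) v != 0.
    by apply: nondeg; rewrite vpick0 -dimv_eq0 dimV.
  set u := vpick _ in uv.
  (* As phi u v and 2 are nonzero, one of u, v, u + v is not isotropic. *)
  case: (eqVneq (phi u u) 0) => [u0|]; last by exists u.
  case: (eqVneq (phi v v) 0) => [v0|]; last by exists v.
  exists (u + v); rewrite linearDl !linearDr /= u0 v0 add0r addr0 [phi v u]phiC.
  by rewrite -mulr2n -mulr_natl mulf_neq0.
have [w [w0 e1w]] : exists w, w != 0 /\ phi e1 w = 0.
  exists (vpick (orthov phi <[e1]>)); split.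
    rewrite vpick0 -dimv_eq0 -lt0n.
    have := leq_dim_orthov1 phi e1 fullv; rewrite dimV capfv; exact: leq_trans.
  rewrite phiC; apply/eqP; rewrite -mem_orthov1; exact: memv_pick.
have spanV v : exists x y, v = x *: e1 + y *: w.
  have fr : free [:: e1; w].
    rewrite free_cons seq1_free w0 span_seq1 andbT; apply/vlineP => -[k e1k].
    have := oner_neq0 F; rewrite -e11 {2}e1k linearZr /= e1w mulr0 eqxx //.
  have /eqP sp : <<[:: e1; w]>>%VS == fullv.
    by rewrite eqEdim subvf /= dimV (eqnP fr).
  have : v \in <<[:: e1; w]>>%VS by rewrite sp memvf.
  rewrite span_cons span_seq1 => /memv_addP[_ /vlineP[x ->] [_ /vlineP[y ->]
    ->]].
  by exists x, y.
(* Otherwise w would be orthogonal to e1 and to itself, hence to all of V. *)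
have ww : phi w w != 0.
  apply/negP => /eqP ww; have [v] := nondeg w w0; have [x [y ->]] := spanV v.
  by rewrite linearDr !linearZr /= ww phiC e1w !mulr0 addr0 eqxx.
have [k kw] := normalize w ww; have k0 : k != 0.
  by apply: contra_eqN kw => /eqP ->; rewrite scale0r linear0l eq_sym oner_eq0.
have e1kw : phi e1 (k *: w) = 0 by rewrite linearZr /= e1w mulr0.
have basisV v : exists x y, v = x *: e1 + y *: (k *: w).
  by have [x [y ->]] := spanV v; exists x, (y / k); rewrite scalerA mulfVK.
exists e1, (k *: w); split=> // v; have [x [y ->]] := basisV v.
move: (k *: w) kw e1kw => e2 e22 e12.
rewrite !linearDr /= !linearZr_LR /= e11 e12 [phi e2 e1]phiC e12 e22.
by rewrite !mulr1 !mulr0 addr0 add0r.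
Qed.

(** A symmetric matrix is a scalar plus a traceless part with rows (s, t) and (t, -s), whose square
    is the scalar s^2 + t^2. The traceless part corresponds to s e1 + t e2. *)
Lemma jform_iso : alg_iso (sym_jmx F 2) (jform phi).
Proof.
have [e1 [e2 [e11 e22 e12 basisV]]] := orthonormal_pair.
have e21 : phi e2 e1 = 0 by rewrite phiC.
pose h (S : sym_jmx F 2) : jform phi := let M : 'M_2 := sym_jmx_val S in
  (2%:R^-1 * (M 0 0 + M 1 1),
   (2%:R^-1 * (M 0 0 - M 1 1)) *: e1 + M 0 1 *: e2).
have h_lin : linear h.
  move=> k [M sM] [N sN]; rewrite /h /=; congr pair; rewrite /= !mxE.
    by rewrite /GRing.scale /=; ring.
  rewrite scalerDr !scalerA addrACA -!scalerDl; congr (_ *: _ + _ *: _); ring.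
pose hL := GRing.isLinear.Build F (sym_jmx F 2) (jform phi) _ h h_lin.
have phiE x y x' y' : phi (x *: e1 + y *: e2) (x' *: e1 + y' *: e2)
    = x * x' + y * y'.
  rewrite linearDl !linearDr /= !linearZl_LR !linearZr_LR /= e11 e12 e21 e22.
  by rewrite !mulr1 !mulr0 addr0 add0r.
exists (HB.pack h hL : {linear sym_jmx F 2 -> jform phi}); split; last first.
  move=> [M sM] [N sN].
  have MC : (M : 'M_2) 1 0 = (M : 'M_2) 0 1 by rewrite -{1}(eqP sM) mxE.
  have NC : (N : 'M_2) 1 0 = (N : 'M_2) 0 1 by rewrite -{1}(eqP sN) mxE.
  change (h (SymJmx sM ** SymJmx sN) = jform_nmul (h (SymJmx sM)) (h (SymJmx
    sN))).
  have MNE i j : (M ** N : 'M_2) i j = 2%:R^-1 *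
      (M i 0 * N 0 j + M i 1 * N 1 j + (N i 0 * M 0 j + N i 1 * M 1 j)).
    have o1 : lift 0 0 = 1 :> 'I_2 by apply: val_inj.
    by rewrite /nmul /= /jmx_nmul !mxE !big_ord_recl !big_ord0 !addr0 o1.
  rewrite /h /jform_nmul /= !MNE MC NC phiE; congr pair; first by field.
  rewrite !scalerDr !scalerA [RHS]addrACA -!scalerDl.
  by congr (_ *: _ + _ *: _); field.
pose gmx (x : jform phi) : jmx F 2 := mx_of_rows 2 2
  [:: [:: x.1 + phi e1 x.2; phi e2 x.2]; [:: phi e2 x.2; x.1 - phi e1 x.2]].
have gmxP x : gmx x \in @trmx_fixed F 2.
  by apply/eqP/matrixP => -[[|[|//]] ?] -[[|[|//]] ?]; rewrite !mxE.
exists (fun x => SymJmx (gmxP x)).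
  move=> [M sM]; apply: val_inj => /=.
  have MC : (M : 'M_2) 1 0 = (M : 'M_2) 0 1 by rewrite -{1}(eqP sM) mxE.
  have phi1 x y : phi e1 (x *: e1 + y *: e2) = x.
    by rewrite linearDr !linearZr_LR /= e11 e12 mulr1 mulr0 addr0.
  have phi2 x y : phi e2 (x *: e1 + y *: e2) = y.
    by rewrite linearDr !linearZr_LR /= e21 e22 mulr1 mulr0 add0r.
  apply/matrixP; elim/ord2_ind; elim/ord2_ind;
    rewrite mxE /= ?phi1 ?phi2 ?MC //;
    by field.
move=> [x v]; rewrite /h /= !mxE /=; congr pair; first by field.
by rewrite [in RHS](basisV v); congr (_ *: _ + _ *: _); field.
Qed.

End SpinFactor.

Lemma alg_iso_trans (F : fieldType) (A B C : comNAlgType F) :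
  alg_iso A B -> alg_iso B C -> alg_iso A C.
Proof.
move=> [h [hK hM]] [k [kK kM]]; exists (k \o h); split; first exact: bij_comp.
by move=> x y; rewrite /= hM kM.
Qed.

Lemma alg_iso_pair (F : fieldType) (A B C : comNAlgType F) :
  alg_iso A B -> alg_iso (C * A)%type (C * B)%type.
Proof.
move=> [h [[k hK kK] hM]].
pose h2 (x : C * A) : C * B := (x.1, h x.2).
have h2_lin : linear h2 by move=> r x y; rewrite /h2 /= linearP.
pose hL := GRing.isLinear.Build F (C * A)%type (C * B)%type _ h2 h2_lin.
exists (HB.pack h2 hL : {linear (C * A)%type -> (C * B)%type}); split.
  exists (fun x => (x.1, k x.2)) => -[x y]; first by rewrite /= hK.
  by rewrite /h2 /= kK.
by move=> x y; rewrite /= /h2 /= hM.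
Qed.

Definition classified (F : fieldType) (A : comNAlgType F) : Prop :=
  (exists n : nat, (1 <= n <= 3)%N /\ alg_iso A (power_alg F n))
  \/ (forall (V : vectType F) (phi : {symmetric V}),
        jform_data 2 phi -> alg_iso A (jform phi))
  \/ (forall (V : vectType F) (phi : {symmetric V}),
        jform_data 2 phi -> alg_iso A (F^o * jform phi)%type)
  \/ alg_iso A (jmx F 2)
  \/ alg_iso A (sym_jmx F 3)
  \/ alg_iso A (jmx F 3).

(** * Case distinction on the four parameters *)

Section Classification.
Variables (F : fieldType) (A : comNAlgType F) (f : A -> A -> F).
Hypothesis Fqc : quadratically_closed F.
Hypothesis two_neq0 : 2%:R != 0 :> F.

Lemma classified_sym2 : alg_iso A (sym_jmx F 2) -> classified A.
Proof.
move=> iso; right; left => V phi phiP.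
exact: alg_iso_trans iso (jform_iso Fqc two_neq0 phiP).
Qed.

(** The pivot is al, or be after exchanging a and c, whichever differs from 1. If both are 1, then
    ga = ps^2, and ps separates the isotropic case from the field itself. *)
Lemma classified_connected a b c al be ga ps : triad f a b c al be ga ps ->
  ps ^+ 2 = al * be * ga -> al != 0 -> be != 0 -> classified A.
Proof.
move=> tP psE al0 be0.
case: (eqVneq al 1) => [al1|al1]; last first.
  have [] := triad_iso_sym_pivot Fqc two_neq0 tP psE al0 be0 al1.
    exact: classified_sym2.
  by move=> iso; do 4!right; left.
case: (eqVneq be 1) => [be1|be1]; last first.
  have psE' : ps ^+ 2 = be * al * ga by rewrite psE; ring.
  have [] := triad_iso_sym_pivot Fqc two_neq0 (triad_flip tP) psE' be0 al0 be1.
    exact: classified_sym2.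
  by move=> iso; do 4!right; left.
rewrite {al0 be0}al1 be1 !mul1r in tP psE.
case: (eqVneq ps 1) => [ps1|ps1]; last first.
  do 4!right; left; exact: (triad_iso_sym_isotropic Fqc two_neq0 tP psE ps1).
left; exists 1%N; split=> //.
rewrite -psE {ga psE}ps1 expr1n in tP.
apply: (triad_iso two_neq0 tP); apply: (power_triad two_neq0 (i0 := ord0)
  (i1 := ord0) (i2 := ord0)) => i; apply: Or31; exact: ord1.
Qed.

(** The axis c is orthogonal to a and b. The value of al tells whether the models of a and b are
    orthogonal, coincide, or generate the symmetric matrices of size 2. *)
Lemma classified_isolated a b c al : triad f a b c al 0 0 0 -> classified A.
Proof.
move=> tP; case: (eqVneq al 0) => [al0|al0].
  left; exists 3%N; split=> //; rewrite al0 in tP.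
  apply: (triad_iso two_neq0 tP); apply: (power_triad two_neq0 (n := 3)
    (i0 := 0) (i1 := 1) (i2 := 2%:R)).
  by elim/ord3_ind; [apply: Or31|apply: Or32|apply: Or33].
case: (eqVneq al 1) => [al1|al1].
  left; exists 2%N; split=> //; rewrite al1 in tP.
  apply: (triad_iso two_neq0 tP); apply: (power_triad two_neq0 (n := 2)
    (i0 := 0) (i1 := 0) (i2 := 1)).
  by elim/ord2_ind; [apply: Or31|apply: Or33].
do 2!right; left => V phi phiP.
apply: alg_iso_trans (triad_iso_product Fqc two_neq0 tP al0 al1) _.
exact/alg_iso_pair/jform_iso.
Qed.

Lemma triad_classified a b c al be ga ps :
  triad f a b c al be ga ps -> classified A.
Proof.
move=> tP; case: (eqVneq (ps ^+ 2) (al * be * ga)) => [psE|psE]; last first.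
  have [iso|iso] := triad_iso_jmx Fqc two_neq0 tP psE; first by do 3!right;
    left.
  by do 5!right.
have tB := triad_cycle tP; have tC := triad_cycle tB.
have psB : ps ^+ 2 = be * ga * al by rewrite psE; ring.
have psC : ps ^+ 2 = ga * al * be by rewrite psE; ring.
have ps0 : al * be * ga = 0 -> ps = 0.
  by move=> e; apply/eqP; rewrite -sqrf_eq0 psE e.
(* If two of al, be, ga are nonzero, a rotation puts them first; otherwise a rotation puts first the
   only one that may be nonzero, and ps = 0. *)
case: (eqVneq al 0) => [al0|al0]; case: (eqVneq be 0) => [be0|be0].
- rewrite al0 be0 ps0 ?al0 ?mul0r // in tC.
  exact: classified_isolated tC.
- case: (eqVneq ga 0) => [ga0|ga0]; last exact: (classified_connected tB).
  rewrite al0 ga0 ps0 ?ga0 ?mulr0 // in tB.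
  exact: classified_isolated tB.
- case: (eqVneq ga 0) => [ga0|ga0]; last exact: (classified_connected tC).
  rewrite be0 ga0 ps0 ?ga0 ?mulr0 // in tP.
  exact: classified_isolated tP.
exact: (classified_connected tP).
Qed.

End Classification.

Theorem theorem1 (F : fieldType) (A : comNAlgType F) (B : {symmetric A}) :
  quadratically_closed F ->
  2%N \notin [pchar F] -> 3%N \notin [pchar F] ->
  jordan_type_half A -> three_generated A ->
  normalized_frobenius_form B ->
  (forall x : A, in_radical B x -> x = 0) ->
  (exists n : nat, (1 <= n <= 3)%N /\ alg_iso A (power_alg F n))
  \/ (forall (V : vectType F) (phi : {symmetric V}),
        jform_data 2 phi -> alg_iso A (jform phi))
  \/ (forall (V : vectType F) (phi : {symmetric V}),
        jform_data 2 phi -> alg_iso A (F^o * jform phi)%type)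
  \/ alg_iso A (jmx F 2)
  \/ alg_iso A (sym_jmx F 3)
  \/ alg_iso A (jmx F 3).
Proof.
move=> Fqc char2 _ _ [a [b [c [aP bP cP gen]]]] BP B_nondeg.
have two_neq0 : 2%:R != 0 :> F by move: char2; rewrite inE.
exact: (triad_classified Fqc two_neq0 (axis_triad two_neq0 BP B_nondeg aP bP cP
  gen)).
Qed.
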